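(* Let $n\ge 1$ and let $f:\mathbb{H}^n\to\mathbb{H}$ be holomorphic with $f(\lambda,\ldots,\lambda)=\lambda$ for all $\lambda\in\mathbb{H}$. Suppose in addition that there is some $T>0$ such that $f(z_1+T,\ldots,z_n+T)=f(z_1,\ldots,z_n)+T$ for all $(z_1,\ldots,z_n)\in\mathbb{H}^n$. Then $f(z_1,\ldots,z_n)=\sum_{j=1}^n\alpha_j z_j$ for all $(z_1,\ldots,z_n)\in\mathbb{H}^n$, where $\alpha_j=\frac{\partial f}{\partial z_j}(i,\ldots,i)$.
   Context: $\mathbb{H}=\{\lambda\in\mathbb{C}:\operatorname{Im}(\lambda)>0\}$ is the upper half-plane and $\mathbb{H}^n$ is its $n$-fold Cartesian product. *)

(* Defs.v *)
From HB Require Import structures.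
From mathcomp Require Import all_boot all_order all_algebra.
From mathcomp Require Import all_classical all_reals all_analysis.
From mathcomp Require Import complex.
Set Implicit Arguments.
Unset Strict Implicit.
Unset Printing Implicit Defensive.
Import Order.TTheory GRing.Theory Num.Theory.
Import numFieldNormedType.Exports.
Local Open Scope classical_set_scope.
Local Open Scope ring_scope.
Local Open Scope complex_scope.

(* The topology and norm that every numFieldType carries over itself are only
   found by unification on abstract field types; this registers them on R[i]. *)
HB.instance Definition _ (R : realType) := NormedModule.copy R[i] R[i]^o.

Definition upper_half_plane (R : realType) : set R[i] :=
  [set z | 0 < complex.Im z].

(* The n-fold Cartesian product of the upper half-plane, as a subset of C^n. *)
Definition upper_half_space (R : realType) (n : nat) : set 'rV[R[i]]_n :=
  [set z | forall j, upper_half_plane (z ord0 j)].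

(* To be used with A open. The scalar field is R[i], so the differentials are
   C-linear and this is complex (Frechet) differentiability. *)
Definition holomorphic_on (R : realType) (n : nat) (A : set 'rV[R[i]]_n)
    (f : 'rV[R[i]]_n -> R[i]) : Prop :=
  forall z, A z -> differentiable f z.

(* The increments in the limit defining 'D_v f range over R[i], so this is the
   complex partial derivative. *)
Definition partial_derivative (R : realType) (n : nat)
    (f : 'rV[R[i]]_n -> R[i]) (j : 'I_n) (a : 'rV[R[i]]_n) : R[i] :=
  'D_(delta_mx ord0 j) f a.

(* Main.v *)
(* For real x put F_x(w) = f(x + w(1,...,1)), a self-map of the upper half-plane with
   F_x(w + T) = F_x(w) + T. The Schwarz-Pick inequality at the points w and w + T gives
   Im F_x(w) >= Im w. For large s the map w |-> f(is + w x) sends a disc of radius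
   comparable to s into the half-plane and 0 to is, so Schwarz's lemma bounds it by O(s),
   its unit increments by O(1), and the differences of these increments by O(1/s). Hence
   F_x(is) + F_{-x}(is) - 2is and F_{2x}(is) + is - 2 F_x(is) tend to 0. By the first limit
   the T-periodic function F_x(w) - w, whose imaginary part is nonnegative, has imaginary part
   tending to 0 along the imaginary axis; by the Phragmen-Lindelof and minimum principles it
   is a constant c(x). By the second limit c(2x) = 2 c(x), so c is the differential of f at
   (i,...,i) and f agrees with sum alpha_j z_j wherever all Im z_j are equal. A reflection
   argument on complex lines extends this to the whole of H^n. The complex analysis used is
   Goursat's theorem, and the maximum principle on rectangles, obtained from the vanishing
   contour integral of (g(z) - g(p))^2 / (z - p), which needs no removable singularities. *)

Require Import Defs.
From mathcomp Require Import all_boot all_order all_algebra.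
From mathcomp Require Import all_classical all_reals all_analysis.
From mathcomp Require Import complex.
From mathcomp Require Import ring lra.
Set Implicit Arguments.
Unset Strict Implicit.
Unset Printing Implicit Defensive.
Import Order.TTheory GRing.Theory Num.Theory.
Import numFieldNormedType.Exports.
Local Open Scope classical_set_scope.
Local Open Scope ring_scope.
Local Open Scope complex_scope.

Local Notation normc := Normc.normc.
Local Notation Re := complex.Re.
Local Notation Im := complex.Im.

(** * Modulus, real and imaginary parts *)

Section ComplexModulus.
Variable R : realType.
Implicit Types (z w p : R[i]) (a b : R).

Lemma normc_ge0 z : 0 <= normc z.
Proof. by case: z => a b; exact: sqrtr_ge0. Qed.

Lemma normcD z w : normc (z + w) <= normc z + normc w.
Proof. exact: (@le_normcD R). Qed.

Lemma normcNE z : normc (- z) = normc z.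
Proof. exact: (@normcN R). Qed.

Lemma normcB z w : normc (z - w) <= normc z + normc w.
Proof. by rewrite (le_trans (normcD _ _))// normcNE. Qed.

Lemma normc_distC z w : normc (z - w) = normc (w - z).
Proof. by rewrite -normcNE opprB. Qed.

Lemma normcX z n : normc (z ^+ n) = normc z ^+ n.
Proof.
elim: n => [|n IH]; first by rewrite !expr0 Normc.normc1.
by rewrite !exprS Normc.normcM IH.
Qed.

Lemma normcR a : normc a%:C = `|a|.
Proof. by rewrite /= expr0n/= addr0 sqrtr_sqr. Qed.

Lemma normci z : normc ('i%C * z) = normc z.
Proof. by rewrite Normc.normcM /= expr0n/= expr1n add0r sqrtr1 mul1r. Qed.

Lemma normc_eq0 z : (normc z == 0) = (z == 0).
Proof.
apply/eqP/eqP => [|->]; first exact: Normc.eq0_normc.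
exact: Normc.normc0.
Qed.

Lemma normc_gt0 z : (0 < normc z) = (z != 0).
Proof. by rewrite lt_def normc_eq0 normc_ge0 andbT. Qed.

Lemma sqr_normcE z : normc z ^+ 2 = Re z ^+ 2 + Im z ^+ 2.
Proof. by case: z => a b /=; rewrite sqr_sqrtr// addr_ge0// sqr_ge0. Qed.

Lemma le_Re_normc z : `|Re z| <= normc z.
Proof.
rewrite -(@ler_pXn2r _ 2)// ?nnegrE ?normc_ge0// sqr_normcE.
by rewrite real_normK ?num_real// lerDl sqr_ge0.
Qed.

Lemma le_Im_normc z : `|Im z| <= normc z.
Proof.
rewrite -(@ler_pXn2r _ 2)// ?nnegrE ?normc_ge0// sqr_normcE.
by rewrite real_normK ?num_real// lerDr sqr_ge0.
Qed.

Lemma normc_le_ReIm z : normc z <= `|Re z| + `|Im z|.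
Proof.
rewrite -(@ler_pXn2r _ 2)// ?nnegrE ?normc_ge0// ?addr_ge0// sqr_normcE.
have := normr_ge0 (Re z); have := normr_ge0 (Im z).
rewrite -(real_normK (num_real (Re z))) -(real_normK (num_real (Im z))).
by nra.
Qed.

Lemma cReD z w : Re (z + w) = Re z + Re w. Proof. by case: z w => ? ? []. Qed.
Lemma cImD z w : Im (z + w) = Im z + Im w. Proof. by case: z w => ? ? []. Qed.
Lemma cReN z : Re (- z) = - Re z. Proof. by case: z. Qed.
Lemma cImN z : Im (- z) = - Im z. Proof. by case: z. Qed.
Lemma cReM z w : Re (z * w) = Re z * Re w - Im z * Im w.
Proof. by case: z w => ? ? []. Qed.
Lemma cImM z w : Im (z * w) = Re z * Im w + Im z * Re w.
Proof. by case: z w => ? ? []. Qed.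

Lemma complexP z w : Re z = Re w -> Im z = Im w -> z = w.
Proof. by case: z w => ? ? [? ?] /= -> ->. Qed.

End ComplexModulus.

(** * Complex differentiability *)

Section EpsilonDelta.
Variable R : realType.
Implicit Types (z w p : R[i]) (g : R[i] -> R[i]).

(** The norm of [R[i]] takes values in [R[i]] itself. This lemma and [gtc0_real] pass to real radii
    and tolerances, since a number above 0 in the order of [R[i]] is real. *)
Lemma normr_lt_real z (e : R) : (`|z| < e%:C) = (normc z < e).
Proof. exact: ltcR. Qed.

Lemma gtc0_real (e : R[i]) : 0 < e -> exists2 e' : R, 0 < e' & e = e'%:C.
Proof.
by case: e => a b; rewrite ltcE/= => /andP[/eqP-> a0]; exists a.
Qed.

Lemma continuous_epsP g p : {for p, continuous g} <->
  forall e : R, 0 < e -> exists2 d : R, 0 < d &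
    forall z, normc (z - p) < d -> normc (g z - g p) < e.
Proof.
split=> [/cvgrPdist_lt gp e e0 | gp].
  have /gp : 0 < e%:C by rewrite ltcR.
  move=> /nbhs_ballP[d /= d0 hd].
  have [d' d'0 dE] := gtc0_real d0; exists d' => // z zd.
  have := hd z; rewrite /ball/= dE !normr_lt_real.
  by rewrite (normc_distC p) (normc_distC (g p)); exact.
suff : g x @[x --> p] --> g p by [].
apply: (iffRL (@cvgrPdist_lt _ _ _ _ (nbhs_filter p) _ _)) => e e0.
have [e' e'0 ->] := gtc0_real e0; have [d d0 hd] := gp _ e'0.
apply/nbhs_ballP; exists d%:C; first by rewrite /= ltcR.
move=> z; rewrite /ball/= !normr_lt_real normc_distC => /hd.
by rewrite normc_distC.
Qed.

(* A Variant rather than a Definition, so that unification does not unfold [derivable]. *)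
Variant cderivable g p : Prop := CDerivable of derivable g p 1.

Lemma derivable_continuous g p : cderivable g p -> {for p, continuous g}.
Proof. by move=> [/derivable1_diffP]/differentiable_continuous. Qed.

(** First-order expansion in the form used under a contour integral: multiplied out, the estimate on
    difference quotients also holds at [z = p]. *)
Lemma derivable_eps g p : cderivable g p -> exists c : R[i],
  forall e : R, 0 < e -> exists2 d : R, 0 < d &
    forall z, normc (z - p) < d ->
      normc (g z - g p - c * (z - p)) <= e * normc (z - p).
Proof.
move=> [/cvg_ex[/= c /cvgrPdist_lt hc]]; exists c => e e0.
have /hc : 0 < e%:C by rewrite ltcR.
move=> /nbhs_ballP[d /= d0 hd].
have [d' d'0 dE] := gtc0_real d0; exists d' => // z zd.
have [->|zp] := eqVneq z p.
  by rewrite !subrr mulr0 subr0 Normc.normc0 mulr0.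
have zp0 : z - p != 0 by rewrite subr_eq0.
have := hd (z - p); rewrite /ball/= sub0r normrN dE !normr_lt_real => /(_ zd zp0).
rewrite [_ *: 1]mulr1 subrK => /ltW.
have -> : g z - g p - c * (z - p) = - (z - p) * (c - (z - p)^-1 * (g z - g p)).
  by rewrite mulNr [in RHS]mulrBr mulVKf// opprB (mulrC c).
by rewrite Normc.normcM normcNE mulrC => /ler_wpM2r; apply; exact: normc_ge0.
Qed.

Lemma cderivable_cst c z : cderivable (fun=> c : R[i]) z.
Proof. by split; exact: derivable_cst. Qed.

Lemma cderivable_id z : cderivable id z.
Proof. by split; exact: derivable_id. Qed.

Lemma cderivableB g1 g2 z : cderivable g1 z -> cderivable g2 z ->
  cderivable (fun w => g1 w - g2 w) z.
Proof. by move=> [d1] [d2]; split; exact: (derivableB d1 d2). Qed.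

Lemma cderivableD g1 g2 z : cderivable g1 z -> cderivable g2 z ->
  cderivable (fun w => g1 w + g2 w) z.
Proof. by move=> [d1] [d2]; split; exact: (derivableD d1 d2). Qed.

Lemma cderivableM g1 g2 z : cderivable g1 z -> cderivable g2 z ->
  cderivable (fun w => g1 w * g2 w) z.
Proof. by move=> [d1] [d2]; split; exact: (derivableM d1 d2). Qed.

Lemma cderivableX g n z : cderivable g z -> cderivable (fun w => g w ^+ n) z.
Proof.
move=> dg; elim: n => [|n IH]; first exact: cderivable_cst.
rewrite (_ : (fun _ => _) = (fun w => g w * g w ^+ n)); first exact: cderivableM.
by apply/funext => w; rewrite exprS.
Qed.

Lemma cderivableV g z : g z != 0 -> cderivable g z ->
  cderivable (fun w => (g w)^-1) z.
Proof. by move=> gz [dg]; split; exact: (derivableV gz dg). Qed.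

Lemma derivable_sub_cst z c : cderivable (fun w : R[i] => w - c) z.
Proof. by apply: cderivableB; [exact: cderivable_id|exact: cderivable_cst]. Qed.

Lemma derivable_div_sub g z q : z != q -> cderivable g z ->
  cderivable (fun w => g w * (w - q)^-1) z.
Proof.
move=> zq dg; have zq0 : z - q != 0 by rewrite subr_eq0.
exact: cderivableM dg (@cderivableV (fun w => w - q) z zq0 (derivable_sub_cst z q)).
Qed.

End EpsilonDelta.

(** * Integrals of complex functions on segments *)

Section RealIntegral.
Variable R : realType.
Implicit Types (h : R -> R) (a b c : R).
Local Notation mu := (@lebesgue_measure R).

Definition continuous_itv h a b := forall t, a <= t <= b -> {for t, continuous h}.

Definition rint h a b : R := \int[mu]_(t in `[a, b]) h t.

Lemma continuous_itv_integrable h a b : continuous_itv h a b ->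
  mu.-integrable `[a, b] (EFin \o h).
Proof.
move=> ch; apply: continuous_compact_integrable; first exact: segment_compact.
by apply: continuous_in_subspaceT => t; rewrite inE /= in_itv /=; exact: ch.
Qed.

Lemma rint_split h a b c : a <= c <= b -> continuous_itv h a b ->
  rint h a b = rint h a c + rint h c b.
Proof.
move=> /andP[ac cb] ch; have ih := continuous_itv_integrable ch.
apply/eqP; rewrite addrC -subr_eq; apply/eqP; rewrite /rint.
rewrite (@Rintegral_itvB _ _ _ _ c) ?bnd_simp//.
apply: Rintegral_itv_obnd_cbnd; apply: integrableS ih => //.
by apply: subset_itvr; rewrite bnd_simp.
Qed.

Lemma rintD h1 h2 a b : continuous_itv h1 a b -> continuous_itv h2 a b ->
  rint (fun t => h1 t + h2 t) a b = rint h1 a b + rint h2 a b.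
Proof. by move=> c1 c2; apply: RintegralD => //; exact: continuous_itv_integrable. Qed.

Lemma rintZ h a b c : continuous_itv h a b ->
  rint (fun t => c * h t) a b = c * rint h a b.
Proof. by move=> c1; apply: RintegralZl => //; exact: continuous_itv_integrable. Qed.

Lemma rint_cst a b c : a <= b -> rint (fun=> c) a b = c * (b - a).
Proof.
have muab : a <= b -> mu `[a, b] = (b - a)%:E.
  move=> ab; rewrite lebesgue_measure_itv/= lte_fin; case: ltP => // ba.
  have -> : b = a by apply/eqP; rewrite eq_le ab ba.
  by rewrite subrr.
by move=> /muab ab; rewrite /rint Rintegral_cst// [X in fine X]ab.
Qed.

Lemma le_rint h1 h2 a b : continuous_itv h1 a b -> continuous_itv h2 a b ->
  (forall t, a <= t <= b -> h1 t <= h2 t) -> rint h1 a b <= rint h2 a b.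
Proof.
move=> c1 c2 le12; by apply: le_Rintegral => //; exact: continuous_itv_integrable.
Qed.

Lemma eq_rint h1 h2 a b : (forall t, a <= t <= b -> h1 t = h2 t) ->
  rint h1 a b = rint h2 a b.
Proof.
by move=> e; apply: eq_Rintegral => t; rewrite inE/= in_itv/=; exact: e.
Qed.

Lemma continuous_itv_cst a b c : continuous_itv (fun=> c) a b.
Proof. by move=> t _; exact: cvg_cst. Qed.

Lemma rint_ge h a b c : a <= b -> continuous_itv h a b ->
  (forall t, a <= t <= b -> c <= h t) -> c * (b - a) <= rint h a b.
Proof.
by move=> ab ch le; rewrite -rint_cst//; apply: le_rint => //; exact: continuous_itv_cst.
Qed.

Lemma rint_le h a b c : a <= b -> continuous_itv h a b ->
  (forall t, a <= t <= b -> h t <= c) -> rint h a b <= c * (b - a).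
Proof.
by move=> ab ch le; rewrite -rint_cst//; apply: le_rint => //; exact: continuous_itv_cst.
Qed.

Lemma continuous_itvZ h a b c : continuous_itv h a b ->
  continuous_itv (fun t => c * h t) a b.
Proof. by move=> c1 t tab; apply: cvgM; [exact: cvg_cst|exact: c1]. Qed.

End RealIntegral.

Section ComplexIntegral.
Variable R : realType.
Implicit Types (h : R -> R[i]) (a b c : R).

Definition ccontinuous_itv h a b :=
  continuous_itv (fun t => Re (h t)) a b /\ continuous_itv (fun t => Im (h t)) a b.

Definition cint h a b : R[i] :=
  rint (fun t => Re (h t)) a b +i* rint (fun t => Im (h t)) a b.

Lemma cint_split h a b c : a <= c <= b -> ccontinuous_itv h a b ->
  cint h a b = cint h a c + cint h c b.
Proof. by move=> acb [cr ci]; rewrite /cint (rint_split acb cr) (rint_split acb ci). Qed.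

Lemma eq_cint h1 h2 a b : (forall t, a <= t <= b -> h1 t = h2 t) ->
  cint h1 a b = cint h2 a b.
Proof. by move=> e; congr (_ +i* _); apply: eq_rint => t /e ->. Qed.

Lemma cintD h1 h2 a b : ccontinuous_itv h1 a b -> ccontinuous_itv h2 a b ->
  cint (fun t => h1 t + h2 t) a b = cint h1 a b + cint h2 a b.
Proof.
move=> [r1 i1] [r2 i2]; apply: complexP => /=; rewrite -rintD//; apply: eq_rint => t _.
- by rewrite cReD.
- by rewrite cImD.
Qed.

Lemma cintZ h a b (k : R[i]) : ccontinuous_itv h a b ->
  cint (fun t => k * h t) a b = k * cint h a b.
Proof.
move=> [r1 i1]; apply: complexP.
  rewrite cReM /= -mulNr -!rintZ// -rintD; [|exact: continuous_itvZ..].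
  by apply: eq_rint => t _; rewrite cReM mulNr.
rewrite cImM /= -!rintZ// -rintD; [|exact: continuous_itvZ..].
by apply: eq_rint => t _; rewrite cImM.
Qed.

Lemma cint_cst a b (k : R[i]) : a <= b -> cint (fun=> k) a b = k * (b - a)%:C.
Proof.
move=> ab; rewrite /cint !rint_cst//.
by case: k => x y /=; apply: complexP; rewrite /= mulr0 ?subr0 ?add0r.
Qed.

(** Real and imaginary parts are bounded separately, whence the factor 2; the later arguments
    tolerate any fixed constant. *)
Lemma normc_cint h a b M : a <= b -> ccontinuous_itv h a b ->
  (forall t, a <= t <= b -> normc (h t) <= M) ->
  normc (cint h a b) <= 2 * M * (b - a).
Proof.
move=> ab [cr ci] hM; rewrite (le_trans (normc_le_ReIm _))//=.
have bnd (u : R -> R) : continuous_itv u a b ->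
    (forall t, a <= t <= b -> `|u t| <= M) -> `|rint u a b| <= M * (b - a).
  move=> cu uM; rewrite ler_norml -mulNr rint_ge//=; last first.
    by move=> t /uM; rewrite ler_norml => /andP[].
  by rewrite rint_le// => t /uM; rewrite ler_norml => /andP[].
rewrite -mulrA mulrDl mul1r lerD// bnd// => t /hM; apply: le_trans.
- exact: le_Re_normc.
- exact: le_Im_normc.
Qed.

Lemma ccontinuous_eps h a b :
  (forall t, a <= t <= b -> forall e, 0 < e -> exists2 d, 0 < d &
     forall s, `|s - t| < d -> normc (h s - h t) < e) ->
  ccontinuous_itv h a b.
Proof.
move=> he; split=> t /he ht;
  (suff : forall e, 0 < e -> exists2 d, 0 < d & forall s, `|s - t| < d ->
     normc (h s - h t) < e); do ?exact: ht; move=> {}ht.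
- suff : (fun s => Re (h s)) s @[s --> t] --> Re (h t) by [].
  apply/cvgrPdist_lt => e /ht[d d0 hd]; apply/nbhs_ballP; exists d => // s /= ts.
  rewrite distrC -cReN -cReD (le_lt_trans (le_Re_normc _))//; apply: hd.
  by rewrite distrC.
- suff : (fun s => Im (h s)) s @[s --> t] --> Im (h t) by [].
  apply/cvgrPdist_lt => e /ht[d d0 hd]; apply/nbhs_ballP; exists d => // s /= ts.
  rewrite distrC -cImN -cImD (le_lt_trans (le_Im_normc _))//; apply: hd.
  by rewrite distrC.
Qed.

End ComplexIntegral.

(** * Contour integrals over rectangles *)

Section Contour.
Variable R : realType.
Implicit Types (g : R[i] -> R[i]) (x y A B : R) (p z : R[i]).

Definition in_rect x y A B p := x <= Re p <= x + A /\ y <= Im p <= y + B.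

Definition on_bdry x y A B p := in_rect x y A B p /\
  [\/ Re p = x, Re p = x + A, Im p = y | Im p = y + B].

Definition bdry_continuous g x y A B :=
  forall p, on_bdry x y A B p -> {for p, continuous g}.

(** Counterclockwise, starting with the bottom side: ['i] is the velocity on the vertical sides, and
    the minus signs reverse the top and left sides. *)
Definition contour g x y A B : R[i] :=
  cint (fun t => g (t +i* y)) x (x + A)
  + 'i%C * cint (fun t => g ((x + A) +i* t)) y (y + B)
  - cint (fun t => g (t +i* (y + B))) x (x + A)
  - 'i%C * cint (fun t => g (x +i* t)) y (y + B).

Lemma continuous_hline g y a b :
  (forall t, a <= t <= b -> {for t +i* y, continuous g}) ->
  ccontinuous_itv (fun t => g (t +i* y)) a b.
Proof.
move=> cg; apply: ccontinuous_eps => t /cg/continuous_epsP gt e /gt[d d0 hd].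
exists d => // s st; apply: hd.
have -> : s +i* y - (t +i* y) = (s - t)%:C by apply: complexP => //=; exact: subrr.
by rewrite normcR.
Qed.

Lemma continuous_vline g x a b :
  (forall t, a <= t <= b -> {for x +i* t, continuous g}) ->
  ccontinuous_itv (fun t => g (x +i* t)) a b.
Proof.
move=> cg; apply: ccontinuous_eps => t /cg/continuous_epsP gt e /gt[d d0 hd].
exists d => // s st; apply: hd.
have -> : x +i* s - (x +i* t) = 'i%C * (s - t)%:C.
  by apply: complexP => /=; ring.
by rewrite normci normcR.
Qed.

Lemma bdry_sides x y A B (P : R[i] -> Prop) : 0 <= A -> 0 <= B ->
  (forall p, on_bdry x y A B p -> P p) ->
  [/\ forall t, x <= t <= x + A -> P (t +i* y),
      forall t, y <= t <= y + B -> P ((x + A) +i* t),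
      forall t, x <= t <= x + A -> P (t +i* (y + B)) &
      forall t, y <= t <= y + B -> P (x +i* t)].
Proof.
move=> A0 B0 hP; split=> t ht; apply: hP; split; rewrite /in_rect /= ?ht ?lexx ?lerDl ?A0 ?B0 //.
- exact: Or43.
- exact: Or42.
- exact: Or44.
- exact: Or41.
Qed.

Lemma bdry_continuous_sides g x y A B : 0 <= A -> 0 <= B ->
  bdry_continuous g x y A B ->
  [/\ ccontinuous_itv (fun t => g (t +i* y)) x (x + A),
      ccontinuous_itv (fun t => g ((x + A) +i* t)) y (y + B),
      ccontinuous_itv (fun t => g (t +i* (y + B))) x (x + A) &
      ccontinuous_itv (fun t => g (x +i* t)) y (y + B)].
Proof.
move=> A0 B0 /(bdry_sides A0 B0)[s1 s2 s3 s4]; split.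
- exact: (@continuous_hline g y _ _ s1).
- exact: (@continuous_vline g (x + A) _ _ s2).
- exact: (@continuous_hline g (y + B) _ _ s3).
- exact: (@continuous_vline g x _ _ s4).
Qed.

Lemma eq_contour g1 g2 x y A B : 0 <= A -> 0 <= B ->
  (forall p, on_bdry x y A B p -> g1 p = g2 p) ->
  contour g1 x y A B = contour g2 x y A B.
Proof.
move=> A0 B0 /(bdry_sides A0 B0)[s1 s2 s3 s4]; rewrite /contour.
by rewrite (eq_cint s1) (eq_cint s2) (eq_cint s3) (eq_cint s4).
Qed.

Lemma contourD g1 g2 x y A B : 0 <= A -> 0 <= B ->
  bdry_continuous g1 x y A B -> bdry_continuous g2 x y A B ->
  contour (fun z => g1 z + g2 z) x y A B = contour g1 x y A B + contour g2 x y A B.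
Proof.
move=> A0 B0 /(bdry_continuous_sides A0 B0)[a1 a2 a3 a4].
move=> /(bdry_continuous_sides A0 B0)[b1 b2 b3 b4].
by rewrite /contour !cintD//; ring.
Qed.

Lemma contourZ g k x y A B : 0 <= A -> 0 <= B -> bdry_continuous g x y A B ->
  contour (fun z => k * g z) x y A B = k * contour g x y A B.
Proof.
move=> A0 B0 /(bdry_continuous_sides A0 B0)[a1 a2 a3 a4].
by rewrite /contour !cintZ//; ring.
Qed.

Lemma normc_contour g x y A B M : 0 <= A -> 0 <= B -> bdry_continuous g x y A B ->
  (forall p, on_bdry x y A B p -> normc (g p) <= M) ->
  normc (contour g x y A B) <= 4 * M * (A + B).
Proof.
move=> A0 B0 /(bdry_continuous_sides A0 B0)[a1 a2 a3 a4].
move=> /(bdry_sides A0 B0)[s1 s2 s3 s4]; rewrite /contour.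
have xA : x <= x + A by rewrite lerDl.
have yB : y <= y + B by rewrite lerDl.
have n1 := normc_cint xA a1 s1; have n2 := normc_cint yB a2 s2.
have n3 := normc_cint xA a3 s3; have n4 := normc_cint yB a4 s4.
move: n1 n2 n3 n4; set c1 := cint _ _ _; set c2 := cint _ _ _.
set c3 := cint _ _ _; set c4 := cint _ _ _ => n1 n2 n3 n4.
have := normcB (c1 + 'i%C * c2 - c3) ('i%C * c4).
have := normcB (c1 + 'i%C * c2) c3.
have := normcD c1 ('i%C * c2).
rewrite !normci.
by lra.
Qed.

Lemma bdry_continuous_affine k0 k1 x y A B :
  bdry_continuous (fun z => k0 + k1 * z) x y A B.
Proof.
move=> p _; apply: derivable_continuous.
apply: cderivableD; first exact: cderivable_cst.
by apply: cderivableM; [exact: cderivable_cst|exact: cderivable_id].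
Qed.

(** For the identity, the integrands on opposite sides differ by a constant; the horizontal pair
    contributes [- 'i * B * A], the vertical pair ['i * A * B]. *)
Lemma contour_affine k0 k1 x y A B : 0 <= A -> 0 <= B ->
  contour (fun z => k0 + k1 * z) x y A B = 0.
Proof.
move=> A0 B0.
have cont k : bdry_continuous (fun z : R[i] => k * z) x y A B.
  move=> p _; apply: derivable_continuous.
  by apply: cderivableM; [exact: cderivable_cst|exact: cderivable_id].
rewrite contourD//; last by move=> p _; apply: derivable_continuous; exact: cderivable_cst.
rewrite (_ : contour (fun=> k0) x y A B = 0) ?add0r; last by rewrite /contour; ring.
rewrite (@contourZ id) //; last by move=> p _; apply: derivable_continuous; exact: cderivable_id.
have /(bdry_continuous_sides A0 B0)[a1 a2 a3 a4] : bdry_continuous (@id R[i]) x y A B.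
  by move=> p _; apply: derivable_continuous; exact: cderivable_id.
have xA : x <= x + A by rewrite lerDl.
have yB : y <= y + B by rewrite lerDl.
rewrite [X in _ * X](_ : _ = 0) ?mulr0// /contour.
have -> : cint (fun t => t +i* y) x (x + A)
    = cint (fun t => t +i* (y + B)) x (x + A) + - 'i%C * B%:C * A%:C.
  rewrite (_ : A%:C = (x + A - x)%:C); last by congr (_%:C); ring.
  rewrite -cint_cst// -cintD//; last by split; exact: continuous_itv_cst.
  by apply: eq_cint => t _; apply: complexP => /=; ring.
have -> : cint (fun t => (x + A) +i* t) y (y + B)
    = cint (fun t => x +i* t) y (y + B) + A%:C * B%:C.
  rewrite [X in _ + _ * X](_ : B%:C = (y + B - y)%:C); last by congr (_%:C); ring.
  rewrite -cint_cst// -cintD//; last by split; exact: continuous_itv_cst.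
  by apply: eq_cint => t _; apply: complexP => /=; ring.
by ring.
Qed.

Lemma contour_hsplit g x y A A' B : 0 <= A -> 0 <= A' -> 0 <= B ->
  (forall p, in_rect x y (A + A') B p -> {for p, continuous g}) ->
  contour g x y (A + A') B = contour g x y A B + contour g (x + A) y A' B.
Proof.
move=> A0 A'0 B0 cg; have AA0 : 0 <= A + A' by rewrite addr_ge0.
have /(bdry_continuous_sides AA0 B0)[a1 a2 a3 a4] : bdry_continuous g x y (A + A') B.
  by move=> p [/cg].
have xm : x <= x + A <= x + (A + A') by rewrite lerDl A0 addrA lerDl.
rewrite /contour (cint_split xm a1) (cint_split xm a3) -!addrA.
by ring.
Qed.

Lemma contour_vsplit g x y A B B' : 0 <= A -> 0 <= B -> 0 <= B' ->
  (forall p, in_rect x y A (B + B') p -> {for p, continuous g}) ->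
  contour g x y A (B + B') = contour g x y A B + contour g x (y + B) A B'.
Proof.
move=> A0 B0 B'0 cg; have BB0 : 0 <= B + B' by rewrite addr_ge0.
have /(bdry_continuous_sides A0 BB0)[a1 a2 a3 a4] : bdry_continuous g x y A (B + B').
  by move=> p [/cg].
have xm : y <= y + B <= y + (B + B') by rewrite lerDl B0 addrA lerDl.
rewrite /contour (cint_split xm a2) (cint_split xm a4) -!addrA.
by ring.
Qed.

End Contour.

(** * Goursat's theorem *)

Section Goursat.
Variable R : realType.
Implicit Types (g : R[i] -> R[i]) (x y A B : R) (p z : R[i]).

Lemma nested_intervals (a b : nat -> R) :
  (forall n, a n <= a n.+1) -> (forall n, b n.+1 <= b n) -> (forall n, a n <= b n) ->
  exists p : R, forall n, a n <= p <= b n.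
Proof.
move=> a_incr b_decr ab.
have /nondecreasing_seqP ha := a_incr; have /nonincreasing_seqP hb := b_decr.
have am m n : a m <= b n.
  have [mn|nm] := leqP m n; first exact: le_trans (ha _ _ mn) (ab n).
  exact: le_trans (ab m) (hb _ _ (ltnW nm)).
exists (sup (range a)) => n; apply/andP; split.
  apply: ub_le_sup; last by exists n.
  by exists (b 0%N) => _ [m _ <-].
by apply: ge_sup; [exists (a 0%N), 0%N | move=> _ [m _ <-]].
Qed.

(** The integrals over the four quarters add up to the whole, so they cannot all have modulus at
    most [e]. Sides are written as sums [A + A] to match the splitting lemmas. *)
Lemma contour_bisect g x y A B e : 0 <= A -> 0 <= B ->
  (forall p, in_rect x y (A + A) (B + B) p -> {for p, continuous g}) ->
  4 * e < normc (contour g x y (A + A) (B + B)) ->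
  exists x' y', [/\ x <= x', x' + A <= x + (A + A), y <= y',
    y' + B <= y + (B + B) & e < normc (contour g x' y' A B)].
Proof.
move=> A0 B0 cg he; apply: contrapT => no.
have bnd x' y' : x <= x' -> x' + A <= x + (A + A) -> y <= y' ->
    y' + B <= y + (B + B) -> normc (contour g x' y' A B) <= e.
  by move=> *; rewrite leNgt; apply/negP => ?; apply: no; exists x', y'.
have AA0 : 0 <= A + A by rewrite addr_ge0.
have b1 := bnd x y; have b2 := bnd (x + A) y.
have b3 := bnd x (y + B); have b4 := bnd (x + A) (y + B).
move: he; rewrite contour_vsplit// !contour_hsplit//; first last.
- move=> p [/andP[p1 p2] /andP[p3 p4]]; apply: cg; split; apply/andP; split=> //.
  by rewrite (le_trans p4)// addrA lerDl.
- move=> p [/andP[p1 p2] /andP[p3 p4]]; apply: cg; split; apply/andP; split=> //.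
    by rewrite (le_trans _ p3)// lerDl.
  by rewrite (le_trans p4)// addrA.
set c1 := contour _ _ _ _ _ in b1 *; set c2 := contour _ _ _ _ _ in b2 *.
set c3 := contour _ _ _ _ _ in b3 *; set c4 := contour _ _ _ _ _ in b4 *.
move=> he; have n0 := normcD (c1 + c2) (c3 + c4).
have n1 := normcD c1 c2; have n2 := normcD c3 c4.
have h1 : x + A <= x + (A + A) by rewrite lerD2l lerDl.
have h2 : y + B <= y + (B + B) by rewrite lerD2l lerDl.
have h3 : x <= x + A by rewrite lerDl.
have h4 : y <= y + B by rewrite lerDl.
have h5 : x + A + A <= x + (A + A) by rewrite addrA.
have h6 : y + B + B <= y + (B + B) by rewrite addrA.
have l1 := b1 (lexx _) h1 (lexx _) h2; have l2 := b2 h3 h5 (lexx _) h2.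
have l3 := b3 (lexx _) h1 h4 h6; have l4 := b4 h3 h5 h4 h6.
have := lerD (lerD l1 l2) (lerD l3 l4); apply/negP; rewrite -ltNge.
apply: lt_le_trans (le_trans n0 (lerD n1 n2)).
by apply: le_lt_trans he; rewrite le_eqVlt; apply/orP; left; apply/eqP; ring.
Qed.

(** Subtracting the affine approximation at [p] does not change the integral and leaves an integrand
    of modulus at most [e * (A + B)]. *)
Lemma contour_local g x y A B p : 0 <= A -> 0 <= B ->
  (forall z, in_rect x y A B z -> {for z, continuous g}) -> in_rect x y A B p ->
  forall c e, (forall z, in_rect x y A B z ->
    normc (g z - g p - c * (z - p)) <= e * normc (z - p)) -> 0 <= e ->
  normc (contour g x y A B) <= 4 * e * (A + B) ^+ 2.
Proof.
move=> A0 B0 cg pin c e ge e0.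
have aff : bdry_continuous (fun z => (c * p - g p) + - c * z) x y A B.
  exact: bdry_continuous_affine.
have cgb : bdry_continuous g x y A B by move=> z [/cg].
have -> : contour g x y A B =
    contour (fun z => g z + ((c * p - g p) + - c * z)) x y A B.
  by rewrite contourD// contour_affine// addr0.
have -> : 4 * e * (A + B) ^+ 2 = 4 * (e * (A + B)) * (A + B) by rewrite expr2; ring.
apply: (normc_contour A0 B0) => [z bz|z [zin _]].
  by apply: continuousD; [exact: cgb|exact: aff].
have -> : g z + ((c * p - g p) + - c * z) = g z - g p - c * (z - p) by ring.
rewrite (le_trans (ge _ zin))// ler_wpM2l// (le_trans (normc_le_ReIm _))//.
case: zin pin => [/andP[z1 z2] /andP[z3 z4]] [/andP[p1 p2] /andP[p3 p4]].
by rewrite cReD cImD cReN cImN lerD// ler_norml; apply/andP; split; lra.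
Qed.

Theorem goursat g x y A B : 0 < A -> 0 < B ->
  (forall p, in_rect x y A B p -> cderivable g p) -> contour g x y A B = 0.
Proof.
move=> A0 B0 dg; apply/eqP; apply: contrapT => /negP; rewrite -normc_gt0 => I0.
have cg p : in_rect x y A B p -> {for p, continuous g}.
  by move=> /dg; exact: derivable_continuous.
(* Halving makes the inequality in [bad] strict already at level 0. *)
pose e := normc (contour g x y A B) / 2.
have e0 : 0 < e by rewrite divr_gt0.
pose bad n (u : R * R) := [/\ x <= u.1, u.1 + A / 2 ^+ n <= x + A, y <= u.2,
  u.2 + B / 2 ^+ n <= y + B & e / 4 ^+ n < normc (contour g u.1 u.2 (A / 2 ^+ n) (B / 2 ^+ n))].
have bad0 : bad 0%N (x, y).
  by rewrite /bad /= !expr0 !divr1; split=> //; rewrite /e ltr_pdivrMr// ltr_pMr// ltr1n.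
have half n (C : R) : C / 2 ^+ n = C / 2 ^+ n.+1 + C / 2 ^+ n.+1.
  by rewrite exprS; field; rewrite expf_neq0//.
(* The state carries its level along with the corner, so that dependent choice applies to a single
   type of bad rectangles. *)
have step (u : {nu : nat * (R * R) | bad nu.1 nu.2}) :
    {v : {nu : nat * (R * R) | bad nu.1 nu.2} | [/\ (sval v).1 = (sval u).1.+1,
      (sval u).2.1 <= (sval v).2.1,
      (sval v).2.1 + A / 2 ^+ (sval u).1.+1 <= (sval u).2.1 + A / 2 ^+ (sval u).1,
      (sval u).2.2 <= (sval v).2.2 &
      (sval v).2.2 + B / 2 ^+ (sval u).1.+1 <= (sval u).2.2 + B / 2 ^+ (sval u).1]}.
  case: u => -[n [a b]] /= [xa aA yb bB he]; apply: cid.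
  have p2 k : 0 < 2 ^+ k :> R by rewrite exprn_gt0.
  have A20 : 0 <= A / 2 ^+ n.+1 by rewrite divr_ge0// ltW.
  have B20 : 0 <= B / 2 ^+ n.+1 by rewrite divr_ge0// ltW.
  move: (aA) (bB) he; rewrite (half n A) (half n B) => aA' bB' he.
  have [||a' [b' [h1 h2 h3 h4 h5]]] := @contour_bisect g a b _ _ (e / 4 ^+ n.+1) A20 B20.
  - move=> p [/andP[p1 p2'] /andP[p3 p4]]; apply: cg; split; apply/andP; split.
    + exact: le_trans p1. + exact: le_trans p2' _. + exact: le_trans p3.
    + exact: le_trans p4 _.
  - apply: le_lt_trans he; rewrite exprS le_eqVlt; apply/orP; left; apply/eqP.
    by field; rewrite expf_neq0.
  have bad' : bad n.+1 (a', b').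
    split=> //=; [exact: le_trans h1|exact: le_trans h2 _|exact: le_trans h3|].
    exact: le_trans h4 _.
  by exists (exist _ (n.+1, (a', b')) bad') => /=; split.
have [s [s0 sS]] := dependent_choice step (exist _ (0%N, (x, y)) bad0).
have sn n : (sval (s n)).1 = n.
  by elim: n => [|n IH]; [rewrite s0|have [-> _ _ _ _] := sS n; rewrite IH].
pose a n := (sval (s n)).2.1; pose b n := (sval (s n)).2.2.
have sbad n : bad n (a n, b n).
  by have := svalP (s n); rewrite sn /a /b; case: (sval (s n)).2.
have p2 k : 0 < 2 ^+ k :> R by rewrite exprn_gt0.
have [px hpx] : exists p : R, forall n, a n <= p <= a n + A / 2 ^+ n.
  apply: nested_intervals => n.
  - by have [_ h _ _ _] := sS n.
  - by have [_ _ h _ _] := sS n; rewrite sn in h.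
  - by rewrite lerDl divr_ge0// ltW.
have [py hpy] : exists p : R, forall n, b n <= p <= b n + B / 2 ^+ n.
  apply: nested_intervals => n.
  - by have [_ _ _ h _] := sS n.
  - by have [_ _ _ _ h] := sS n; rewrite sn in h.
  - by rewrite lerDl divr_ge0// ltW.
pose p := px +i* py.
have pin n : in_rect (a n) (b n) (A / 2 ^+ n) (B / 2 ^+ n) p by split; rewrite /p/=.
have sub n z : in_rect (a n) (b n) (A / 2 ^+ n) (B / 2 ^+ n) z -> in_rect x y A B z.
  have [h1 h2 h3 h4 _] := sbad n; move=> [/andP[z1 z2] /andP[z3 z4]].
  split; apply/andP; split.
  - exact: le_trans z1. - exact: le_trans z2 _. - exact: le_trans z3.
  - exact: le_trans z4 _.
have AB0 : 0 < A + B by rewrite addr_gt0.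
(* With this slope, the bound of [contour_local] on the rectangle of level [n] is exactly
   [e / 4 ^+ n], which contradicts [bad n]. *)
pose e1 := e / (4 * (A + B) ^+ 2).
have e10 : 0 < e1 by rewrite divr_gt0// mulr_gt0// exprn_gt0.
have [c /(_ _ e10)[d d0 hd]] := derivable_eps (dg p (sub _ _ (pin 0%N))).
have [n hn] : exists n, (A + B) / 2 ^+ n < d.
  have [n _ /(_ n (leqnn n))] : \forall n \near \oo, (A + B) / 2 ^+ n < d.
    have : (geometric (A + B) (2^-1 : R)) @ \oo --> (0 : R).
      by apply: cvg_geometric; rewrite ger0_norm ?invr_ge0// invf_lt1// ltr1n.
    move=> /cvgrPdist_lt/(_ _ d0); apply: filterS => n /=.
    rewrite sub0r normrN exprVn ger0_norm//.
    by rewrite divr_ge0// ltW.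
  by exists n.
have /= := contour_local (ltW (divr_gt0 A0 (p2 n))) (ltW (divr_gt0 B0 (p2 n)))
  (fun z h => cg z (sub n z h)) (pin n).
move=> /(_ c e1 _ (ltW e10)); have [_ _ _ _ hb] := sbad n.
suff -> : 4 * e1 * (A / 2 ^+ n + B / 2 ^+ n) ^+ 2 = e / 4 ^+ n.
  move=> H; move: hb; rewrite ltNge H// => z zin; apply: hd; apply: le_lt_trans hn.
  rewrite (le_trans (normc_le_ReIm _))// mulrDl.
  have := pin n; case: zin => [/andP[z1 z2] /andP[z3 z4]] [/andP[q1 q2] /andP[q3 q4]].
  by rewrite cReD cImD cReN cImN lerD// ler_norml; apply/andP; split; lra.
rewrite -mulrDl exprMn exprVn -exprM mulnC exprM (_ : 2 ^+ 2 = 4 :> R); last by rewrite -natrX.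
rewrite /e1; field.
by rewrite expf_neq0//= lt0r_neq0.
Qed.

End Goursat.

(** * The maximum principle on rectangles *)

Section MaximumPrinciple.
Variable R : realType.
Implicit Types (g : R[i] -> R[i]) (x y A B : R) (p z q : R[i]).

Lemma ReV z : Re z^-1 = Re z / normc z ^+ 2.
Proof. by rewrite sqr_normcE; case: z. Qed.

Lemma ImV z : Im z^-1 = - Im z / normc z ^+ 2.
Proof. by rewrite sqr_normcE; case: z => a b /=; rewrite mulNr. Qed.

(** The function is 0 at [p], so its difference quotient there is the square of that of [g]. Hence
    Goursat's theorem applies on rectangles containing [p]. *)
Lemma derivable_sqr_div_sub g p : cderivable g p ->
  cderivable (fun w => (g w - g p) ^+ 2 * (w - p)^-1) p.
Proof.
move=> [/cvg_ex[/= c hc]]; split; apply/cvg_ex; exists (c * c) => /=.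
rewrite (_ : (fun _ => _) = (fun h : R[i] => (h^-1 *: (g (h *: 1 + p) - g p)) *
    (h^-1 *: (g (h *: 1 + p) - g p)))); first exact: cvgM.
apply/funext => h; rewrite subrr expr0n /= mul0r subr0 [h *: 1]mulr1 addrK.
have alg (a b : R[i]) : b * (a ^+ 2 * b) = b * a * (b * a) by ring.
exact: alg.
Qed.

(** One factor [w - q] cancels the division by the increment; the other remains and sends the
    difference quotient to 0, while the [n]-th power converges. *)
Lemma derivable_expr_div_sub g q n : cderivable g q -> g q = 0 ->
  cderivable (fun w => (g w * (w - q)^-1) ^+ n * (w - q) ^+ 2) q.
Proof.
move=> [/cvg_ex[/= c hc]] gq0; split; apply/cvg_ex; exists (c ^+ n * 0) => /=.
rewrite (_ : (fun _ => _) =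
    (fun h : R[i] => (h^-1 *: (g (h *: 1 + q) - g q)) ^+ n * h)).
  apply: cvgM; last exact: nbhs_dnbhs.
  exact: (cvg_comp _ _ hc (derivable_continuous (cderivableX n (cderivable_id c)))).
apply/funext => h; rewrite subrr expr0n /= mulr0 subr0 [h *: 1]mulr1 addrK gq0 subr0.
have [->|h0] := eqVneq h 0.
  by rewrite mulr0 expr0n mulr0; exact: mulr0.
have alg (a b d : R[i]) : b * d = 1 -> b * ((a * b) ^+ n * d ^+ 2) = (b * a) ^+ n * d.
  by move=> bd; rewrite expr2 mulrCA (mulrA b) bd mul1r (mulrC a).
exact/alg/mulVf.
Qed.

Definition in_rect_interior x y A B p := x < Re p < x + A /\ y < Im p < y + B.

Lemma interior_in_rect x y A B p : in_rect_interior x y A B p -> in_rect x y A B p.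
Proof. by move=> [/andP[/ltW p1 /ltW p2] /andP[/ltW p3 /ltW p4]]; split; apply/andP. Qed.

Lemma rect_dist x y A B p z : in_rect x y A B p -> in_rect x y A B z ->
  normc (z - p) <= A + B.
Proof.
move=> [/andP[p1 p2] /andP[p3 p4]] [/andP[z1 z2] /andP[z3 z4]].
rewrite (le_trans (normc_le_ReIm _))// cReD cImD cReN cImN.
by rewrite lerD// ler_norml; apply/andP; split; lra.
Qed.

(* The coarse constant suffices: it is removed by applying the bound to powers of [g]. *)
Lemma interior_bound x y A B p : in_rect_interior x y A B p -> exists2 C, 0 < C &
  forall g, (forall z, in_rect x y A B z -> cderivable g z) ->
  forall M, 0 <= M -> (forall z, on_bdry x y A B z -> normc (g z) <= M) ->
  normc (g p) <= C * M.
Proof.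
move=> pint; have pin := interior_in_rect pint.
case: (pint) => [/andP[p1 p2] /andP[p3 p4]].
have A0 : 0 < A by rewrite -(ltrD2l x) addr0 (lt_trans p1).
have B0 : 0 < B by rewrite -(ltrD2l y) addr0 (lt_trans p3).
have AB0 : 0 < A + B by exact: addr_gt0.
have [r r0 [r1 r2 r3 r4]] : exists2 r : R, 0 < r &
    [/\ r <= Re p - x, r <= x + A - Re p, r <= Im p - y & r <= y + B - Im p].
  exists (Num.min (Num.min (Re p - x) (x + A - Re p)) (Num.min (Im p - y) (y + B - Im p))).
    by rewrite !lt_min !subr_gt0 p1 p2 p3 p4.
  by split; rewrite !ge_min lexx ?orbT.
have rz z : on_bdry x y A B z -> r <= normc (z - p).
  move=> [_ zb]; case: zb => zE.
  - apply: le_trans (le_Re_normc _); rewrite cReD cReN zE distrC.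
    exact: le_trans r1 (ler_norm _).
  - apply: le_trans (le_Re_normc _); rewrite cReD cReN zE.
    exact: le_trans r2 (ler_norm _).
  - apply: le_trans (le_Im_normc _); rewrite cImD cImN zE distrC.
    exact: le_trans r3 (ler_norm _).
  - apply: le_trans (le_Im_normc _); rewrite cImD cImN zE.
    exact: le_trans r4 (ler_norm _).
have zp z : on_bdry x y A B z -> z != p.
  by move=> /rz rz1; rewrite -subr_eq0 -normc_gt0 (lt_le_trans r0).
pose k z := (z - p)^-1.
have ck : bdry_continuous k x y A B.
  move=> z /zp h; apply: derivable_continuous; apply: cderivableV.
    by rewrite subr_eq0.
  exact: derivable_sub_cst.
(* On each side, one of the real and imaginary parts of [(z - p)^-1] has modulus at least [m]: its
   numerator is the distance from [p] to the line of that side, and [normc (z - p) <= A + B]. *)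
pose m := r / (A + B) ^+ 2.
have m0 : 0 < m by rewrite divr_gt0// exprn_gt0.
have mle (z : R[i]) (u : R) : on_bdry x y A B z -> r <= u -> m <= u / normc (z - p) ^+ 2.
  move=> bz ru; have n0 : 0 < normc (z - p) by exact: lt_le_trans r0 (rz _ bz).
  rewrite /m ler_pM ?invr_ge0 ?exprn_ge0 ?(ltW r0) ?(ltW AB0)//.
  rewrite lef_pV2 ?posrE ?exprn_gt0//.
  rewrite ler_pXn2r ?nnegrE ?normc_ge0 ?(ltW AB0)//.
  by apply: (rect_dist pin); case: bz => zin _; exact: zin.
pose K := contour k x y A B.
(* [K] stands in for [2 * pi * i]. On each side that part keeps its sign, and with the orientation
   all four sides contribute positively to [Im K]. *)
have K0 : m * (A + B) <= Im K.
  have [c1 c2 c3 c4] := bdry_continuous_sides (ltW A0) (ltW B0) ck.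
  have [b1 b2 b3 b4] := bdry_sides (ltW A0) (ltW B0) (fun z (h : on_bdry x y A B z) => h).
  have xA : x <= x + A by rewrite lerDl ltW.
  have yB : y <= y + B by rewrite lerDl ltW.
  have i1 : m * (x + A - x) <= Im (cint (fun t => k (t +i* y)) x (x + A)).
    apply: rint_ge => //; first by case: c1.
    by move=> t /b1 bt; rewrite ImV; apply: mle => //; rewrite cImD cImN /= opprB.
  have i2 : m * (y + B - y) <= Re (cint (fun t => k ((x + A) +i* t)) y (y + B)).
    apply: rint_ge => //; first by case: c2.
    by move=> t /b2 bt; rewrite ReV; apply: mle => //; rewrite cReD cReN.
  have i3 : Im (cint (fun t => k (t +i* (y + B))) x (x + A)) <= - m * (x + A - x).
    apply: rint_le => //; first by case: c3.
    move=> t /b3 bt; rewrite ImV mulNr lerN2; apply: mle => //.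
    by rewrite cImD cImN.
  have i4 : Re (cint (fun t => k (x +i* t)) y (y + B)) <= - m * (y + B - y).
    apply: rint_le => //; first by case: c4.
    move=> t /b4 bt; rewrite ReV lerNr -mulNr; apply: mle => //.
    by rewrite cReD cReN /= opprB.
  rewrite /K /contour; move: i1 i2 i3 i4.
  set d1 := cint _ _ _; set d2 := cint _ _ _; set d3 := cint _ _ _; set d4 := cint _ _ _.
  rewrite !cImD !cImN !cImM /= !mul0r !mul1r !add0r.
  move: (Im d1) (Re d2) (Im d3) (Re d4) => a b c d.
  have : 0 < m * A by rewrite mulr_gt0.
  have : 0 < m * B by rewrite mulr_gt0.
  by clear; lra.
pose L := 4 * r^-1 * (A + B).
have L0 : 0 < L by rewrite !mulr_gt0// invr_gt0.
have K1 : 0 < normc K.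
  apply: lt_le_trans (le_trans (ler_norm _) (le_Im_normc K)).
  by apply: lt_le_trans K0; rewrite mulr_gt0.
pose C0 := L / normc K.
have C00 : 0 < C0 by rewrite divr_gt0.
exists (2 * C0 + 1); first by rewrite addr_gt0// mulr_gt0.
move=> g dg M M0 gM.
pose G z := (g z - g p) ^+ 2 * (z - p)^-1.
have dG z : in_rect x y A B z -> cderivable G z.
  move=> zin; have [->|zp1] := eqVneq z p.
    by apply: derivable_sqr_div_sub; exact: dg.
  apply: derivable_div_sub => //; apply: cderivableX.
  by apply: cderivableB; [exact: dg|exact: cderivable_cst].
have G0 : contour G x y A B = 0 by exact: goursat.
pose N z := (2 * g p * g z - g z ^+ 2) * k z.
have cN : bdry_continuous N x y A B.
  move=> z bz; apply: derivable_continuous; apply: derivable_div_sub.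
    exact: zp.
  have dgz := dg _ bz.1.
  apply: cderivableB; last exact: cderivableX.
  by apply: cderivableM => //; exact: cderivable_cst.
have cG : bdry_continuous G x y A B.
  by move=> z [zin _]; apply: derivable_continuous; exact: dG.
(* Expanding the square in [contour G = 0] isolates the term [g p ^+ 2 * K]; what remains involves
   only boundary values of [g] and one factor [g p]. *)
have KE : g p ^+ 2 * K = contour N x y A B.
  rewrite /K -contourZ ?ltW// -[RHS]add0r -G0 -contourD ?ltW//.
  by apply: eq_contour; rewrite ?ltW// => z bz; rewrite /G /N /k; ring.
have NM : normc (contour N x y A B) <= L * (2 * normc (g p) * M + M ^+ 2).
  have -> : L * (2 * normc (g p) * M + M ^+ 2) =
      4 * ((2 * normc (g p) * M + M ^+ 2) * r^-1) * (A + B) by rewrite /L; ring.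
  apply: normc_contour; rewrite ?ltW// => z bz.
  rewrite /N /k Normc.normcM Normc.normcV.
  have n0 : 0 < normc (z - p) by exact: lt_le_trans r0 (rz _ bz).
  rewrite ler_pM ?normc_ge0 ?invr_ge0 ?normc_ge0//; last first.
    by rewrite lef_pV2 ?posrE//; exact: rz.
  rewrite (le_trans (normcB _ _))// normcX !Normc.normcM lerD//.
    rewrite (_ : normc 2 = 2); last by rewrite -(rmorph_nat (real_complex R) 2) normcR ger0_norm.
    by rewrite ler_wpM2l ?mulr_ge0 ?normc_ge0//; exact: gM.
  by rewrite ler_pXn2r ?nnegrE ?normc_ge0//; exact: gM.
(* A quadratic inequality in [a = normc (g p)]: if [a] exceeded [(2 * C0 + 1) * M], then
   [a * (a - 2 * C0 * M)] would exceed [a * M], hence [C0 * M ^+ 2]. *)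
have : normc (g p) ^+ 2 <= C0 * (2 * normc (g p) * M + M ^+ 2).
  rewrite /C0 mulrAC ler_pdivlMr// -normcX -Normc.normcM KE//.
have := normc_ge0 (g p); move: (normc (g p)) C00 M0; clear; move=> a C00 M0 a0 h.
rewrite leNgt; apply/negP => lta.
have h1 : 0 <= C0 * M by rewrite mulr_ge0// ltW.
have h2 : 0 <= (a - M) * M by rewrite mulr_ge0// subr_ge0; lra.
have h3 : C0 * (2 * a * M + M ^+ 2) <= C0 * (a * M) * 2 + C0 * (a * M).
  by have := mulr_ge0 (ltW C00) h2; lra.
by nra.
Qed.

(** Otherwise [C * (b / a) ^+ n] would tend to 0 and drop below 1. *)
Lemma le_of_pow_le (a b C : R) : 0 <= a -> 0 <= b -> 0 < C ->
  (forall n, a ^+ n <= C * b ^+ n) -> a <= b.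
Proof.
move=> a0 b0 C0 h; rewrite leNgt; apply/negP => ba.
have a1 : 0 < a by exact: le_lt_trans ba.
have : (geometric C (b / a)) @ \oo --> (0 : R).
  by apply: cvg_geometric; rewrite ger0_norm ?divr_ge0// ltr_pdivrMr// mul1r.
move=> /cvgrPdist_lt/(_ _ ltr01)[n _ /(_ n (leqnn n))] /=.
rewrite sub0r normrN ger0_norm; last by rewrite mulr_ge0 ?exprn_ge0 ?divr_ge0// ltW.
rewrite expr_div_n mulrA ltr_pdivrMr ?exprn_gt0// mul1r ltNge.
by rewrite h.
Qed.

Theorem maximum_principle x y A B p g M : in_rect_interior x y A B p ->
  (forall z, in_rect x y A B z -> cderivable g z) ->
  0 <= M -> (forall z, on_bdry x y A B z -> normc (g z) <= M) ->
  normc (g p) <= M.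
Proof.
move=> /interior_bound[C C0 hC] dg M0 gM.
apply: (le_of_pow_le _ M0 C0) => [|n]; first exact: normc_ge0.
rewrite -normcX; apply: (hC (fun z => g z ^+ n)); last first.
- by move=> z /gM; rewrite normcX; apply: lerXn2r; rewrite ?nnegrE ?normc_ge0.
- exact: exprn_ge0.
- by move=> z /dg; exact: cderivableX.
Qed.

(* The removable singularity of [g z / (z - q)] at [q] is avoided by applying the bound to
   the everywhere differentiable functions [(g z / (z - q)) ^+ n * (z - q) ^+ 2]. *)
Theorem schwarz_rect x y A B p q g M : in_rect_interior x y A B p ->
  in_rect x y A B q -> g q = 0 ->
  (forall z, in_rect x y A B z -> cderivable g z) ->
  0 <= M -> (forall z, on_bdry x y A B z -> normc (g z) <= M * normc (z - q)) ->
  normc (g p) <= M * normc (p - q).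
Proof.
move=> pint qin gq0 dg M0 gM; have pin := interior_in_rect pint.
have [->|pq] := eqVneq p q; first by rewrite gq0 subrr Normc.normc0 mulr0.
have pq0 : 0 < normc (p - q) by rewrite normc_gt0 subr_eq0.
have [C C0 hC] := interior_bound pint.
case: (pint) => [/andP[p1 p2] /andP[p3 p4]].
have A0 : 0 < A by rewrite -(ltrD2l x) addr0 (lt_trans p1).
have B0 : 0 < B by rewrite -(ltrD2l y) addr0 (lt_trans p3).
have AB0 : 0 < A + B by exact: addr_gt0.
rewrite -ler_pdivrMr//.
(* The factor [(w - q) ^+ 2] is at most [(A + B) ^+ 2] in modulus on the boundary and has modulus
   [normc (p - q) ^+ 2] at [p]; both are independent of [n]. *)
have C1 : 0 < C * (A + B) ^+ 2 / normc (p - q) ^+ 2.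
  by rewrite divr_gt0 ?mulr_gt0 ?exprn_gt0.
apply: (le_of_pow_le _ M0 C1) => [|n]; first by rewrite divr_ge0 ?normc_ge0.
have := hC (fun w => (g w * (w - q)^-1) ^+ n * (w - q) ^+ 2) _ (M ^+ n * (A + B) ^+ 2).
rewrite Normc.normcM !normcX Normc.normcM Normc.normcV => H.
have {}H : (normc (g p) / normc (p - q)) ^+ n * normc (p - q) ^+ 2 <=
    C * (M ^+ n * (A + B) ^+ 2).
  apply: H => [z zin||z bz].
  - have [->|zq] := eqVneq z q; first by apply: derivable_expr_div_sub => //; exact: dg.
    apply: cderivableM; last by apply: cderivableX; exact: derivable_sub_cst.
    by apply: cderivableX; apply: derivable_div_sub => //; exact: dg.
  - by rewrite mulr_ge0 ?exprn_ge0// ltW.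
  - rewrite Normc.normcM !normcX Normc.normcM Normc.normcV.
    (* Since [q] ranges over the closed rectangle, it may be a boundary point; the squared factor
       vanishes there. *)
    have [->|zq] := eqVneq z q.
      rewrite subrr Normc.normc0 expr0n/= mulr0.
      by rewrite mulr_ge0 ?exprn_ge0// ltW.
    have zq0 : 0 < normc (z - q) by rewrite normc_gt0 subr_eq0.
    rewrite ler_pM ?exprn_ge0 ?divr_ge0 ?normc_ge0//.
      by apply: lerXn2r; rewrite ?nnegrE ?divr_ge0 ?normc_ge0// ler_pdivrMr// gM.
    apply: lerXn2r; rewrite ?nnegrE ?normc_ge0 ?(ltW AB0)//.
    by apply: (rect_dist qin); case: bz => zin _; exact: zin.
rewrite -ler_pdivlMr ?exprn_gt0// in H.
apply: le_trans H _; rewrite le_eqVlt; apply/orP; left; apply/eqP.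
by ring.
Qed.

End MaximumPrinciple.

(** * Holomorphic functions on the upper half-plane *)

Section HalfPlane.
Variable R : realType.
Implicit Types (g F phi : R[i] -> R[i]) (p z w q a : R[i]).

Lemma conjRe z : Re z^* = Re z. Proof. by case: z. Qed.
Lemma conjIm z : Im z^* = - Im z. Proof. by case: z. Qed.

Lemma normc_sub_conj z w :
  normc (z - w^*) ^+ 2 = normc (z - w) ^+ 2 + 4 * (Im z * Im w).
Proof. by rewrite !sqr_normcE !(cReD, cImD, cReN, cImN, conjRe, conjIm); ring. Qed.

Lemma le_normc_sub_conj z w : 0 < Im z -> 0 < Im w -> normc (z - w) <= normc (z - w^*).
Proof.
move=> z0 w0; rewrite -(@ler_pXn2r _ 2)// ?nnegrE ?normc_ge0// normc_sub_conj.
by rewrite lerDl !mulr_ge0// ltW.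
Qed.

Lemma sub_conj_neq0 z w : 0 < Im z -> 0 < Im w -> z - w^* != 0.
Proof.
move=> z0 w0; rewrite -normc_eq0 -sqrf_eq0 normc_sub_conj.
by rewrite gt_eqF// ltr_wpDl ?sqr_ge0// !mulr_gt0.
Qed.

Theorem schwarz_pick F w w0 :
  (forall z, 0 < Im z -> cderivable F z /\ 0 < Im (F z)) -> 0 < Im w -> 0 < Im w0 ->
  normc (F w - F w0) ^+ 2 * (Im w * Im w0) <=
  normc (w - w0) ^+ 2 * (Im (F w) * Im (F w0)).
Proof.
move=> FH wH w0H.
pose N z := (F z - F w0) * (z - w0^*) * (F z - (F w0)^*)^-1.
have dN z : 0 < Im z -> cderivable N z.
  move=> /FH[dF Fz0]; apply: cderivableM.
    apply: cderivableM; first by apply: cderivableB => //; exact: cderivable_cst.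
    exact: derivable_sub_cst.
  apply: (@cderivableV _ (fun z => F z - (F w0)^*)).
    by apply: sub_conj_neq0 => //; exact: (FH _ w0H).2.
  by apply: cderivableB => //; exact: cderivable_cst.
have N0 : N w0 = 0 by rewrite /N subrr !mul0r.
have NM z : 0 < Im z -> normc (N z) <= normc (z - w0^*).
  move=> zH; have [_ Fz0] := FH _ zH; have [_ Fw0] := FH _ w0H.
  rewrite /N !Normc.normcM Normc.normcV ler_pdivrMr; last first.
    by rewrite normc_gt0 sub_conj_neq0.
  by rewrite mulrC ler_wpM2l ?normc_ge0// le_normc_sub_conj.
have main : normc (N w) <= normc (w - w0).
  apply/ler_addgt0Pr => e' e'0.
  pose W := normc (w - w0) + 1.
  have W0 : 0 < W by rewrite ltr_wpDl ?normc_ge0.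
  pose e := e' / W; have e0 : 0 < e by rewrite divr_gt0.
  suff : normc (N w) <= (1 + e) * normc (w - w0).
    move=> /le_trans; apply; rewrite mulrDl mul1r lerD2l /e mulrAC ler_pdivrMr//.
    by rewrite ler_wpM2l ?(ltW e'0)// /W lerDl.
  set u := Re w0; set v := Im w0 in w0H *.
  (* On the far sides [Im z <= 2 * L] and [4 * v <= e * L]. On the bottom side
     [Im z = d <= e * v / 8], while the distance to [w0] is at least [v / 2]. *)
  pose L := v + 4 * v / e + normc (w - w0).
  pose d := Num.min (Num.min (v / 2) (e * v / 8)) (Im w / 2).
  have L1 : 0 <= normc (w - w0) by exact: normc_ge0.
  have L2 : 0 < 4 * v / e by rewrite divr_gt0// mulr_gt0.
  have vL : v <= L by rewrite /L; lra.
  have L0 : 0 < L by exact: lt_le_trans vL.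
  have eL : 4 * v <= e * L.
    have -> : 4 * v = e * (4 * v / e) by field; rewrite gt_eqF.
    by rewrite ler_wpM2l ?(ltW e0)// /L; lra.
  have d0 : 0 < d by rewrite !lt_min !divr_gt0// mulr_gt0.
  have [d1 d2 d3] : [/\ d <= v / 2, d <= e * v / 8 & d <= Im w / 2].
    by split; rewrite !ge_min lexx ?orbT.
  have Rw : `|Re w - u| <= normc (w - w0).
    by rewrite /u -cReN -cReD le_Re_normc.
  have Iw : `|Im w - v| <= normc (w - w0).
    by rewrite /v -cImN -cImD le_Im_normc.
  move: Rw Iw; rewrite !ler_norml => /andP[r1 r2] /andP[i1 i2].
  apply: (@schwarz_rect _ (u - L) d (L + L) (L + L - d)) => //.
  - by split; apply/andP; split; rewrite /L; lra.
  - by split; apply/andP; split; rewrite -?/u -?/v; lra.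
  - by move=> z [_ /andP[z3 _]]; apply: dN; exact: lt_le_trans z3.
  - by rewrite addr_ge0// ltW.
  move=> z [[/andP[z1 z2] /andP[z3 z4]] zb].
  have zH : 0 < Im z by exact: lt_le_trans z3.
  rewrite (le_trans (NM z zH))//.
  rewrite -(@ler_pXn2r _ 2) ?nnegrE ?mulr_ge0 ?normc_ge0 ?addr_ge0 ?ltW//.
  rewrite normc_sub_conj exprMn.
  (* Enough because [(1 + e) ^+ 2 >= 1 + 2 * e]. *)
  suff : 4 * (Im z * v) <= 2 * e * normc (z - w0) ^+ 2.
    have : 0 <= e ^+ 2 * normc (z - w0) ^+ 2 by rewrite mulr_ge0 ?sqr_ge0.
    by rewrite -/v; nra.
  rewrite sqr_normcE cReD cImD cReN cImN -/u -/v.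
  have far (s : R) : L <= `|s| -> L ^+ 2 <= s ^+ 2.
    by move=> h; rewrite -(real_normK (num_real s)) lerXn2r ?nnegrE// ltW.
  have z5 : Im z <= 2 * L by lra.
  have hfar : 4 * (Im z * v) <= 2 * e * L ^+ 2.
    have h1 : Im z * v <= 2 * L * v by rewrite ler_wpM2r// ltW.
    have h2 : 4 * v * L <= e * L * L by rewrite ler_wpM2r// ltW.
    by rewrite expr2; lra.
  have e2 : 0 <= 2 * e by rewrite mulr_ge0// ltW.
  have s1 := sqr_ge0 (Re z - u); have s2 := sqr_ge0 (Im z - v).
  case: zb => zE.
  - apply: le_trans hfar _; rewrite ler_wpM2l//.
    have := far (Re z - u); rewrite zE addrC addKr normrN (ger0_norm (ltW L0)) lexx.
    by move=> /(_ isT) h; rewrite -[X in X <= _]addr0 lerD.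
  - apply: le_trans hfar _; rewrite ler_wpM2l//.
    have := far (Re z - u); rewrite zE.
    have -> : u - L + (L + L) - u = L by ring.
    by rewrite (ger0_norm (ltW L0)) lexx => /(_ isT) h; rewrite -[X in X <= _]addr0 lerD.
  - have h1 : (v / 2) ^+ 2 <= (Im z - v) ^+ 2.
      rewrite -(sqrrN (Im z - v)) opprB lerXn2r ?nnegrE; lra.
    have h2 : 4 * (d * v) <= 4 * (e * v / 8 * v) by rewrite ler_wpM2l// ler_wpM2r// ltW.
    apply: le_trans (_ : 2 * e * (v / 2) ^+ 2 <= _); first by rewrite zE; lra.
    by rewrite ler_wpM2l//; lra.
  - apply: le_trans hfar _; rewrite ler_wpM2l//.
    have := far (Im z - v); rewrite zE ger0_norm; last by lra.
    have h0 : L <= d + (L + L - d) - v by lra.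
    by move=> /(_ h0) h; rewrite -[X in X <= _]add0r lerD.
have [_ Fw0] := FH _ w0H; have [_ Fw] := FH _ wH.
move: main; rewrite /N !Normc.normcM Normc.normcV ler_pdivrMr; last first.
  by rewrite normc_gt0 sub_conj_neq0.
move=> h; have {h} : (normc (F w - F w0) * normc (w - w0^*)) ^+ 2 <=
    (normc (w - w0) * normc (F w - (F w0)^*)) ^+ 2.
  by rewrite lerXn2r// nnegrE mulr_ge0 ?normc_ge0.
rewrite !exprMn !normc_sub_conj.
by lra.
Qed.

(** In Schwarz-Pick for [w] and [w + T] both distances equal [T] and the imaginary parts agree in
    pairs; what is left is a comparison of squares. *)
Lemma Im_ge_of_translation F (T : R) w :
  (forall z, 0 < Im z -> cderivable F z /\ 0 < Im (F z)) -> 0 < Im w -> 0 < T ->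
  F (w + T%:C) = F w + T%:C -> Im w <= Im (F w).
Proof.
move=> FH wH T0 FT; have [_ Fw] := FH _ wH.
have ImT : Im (w + T%:C) = Im w by rewrite cImD /= addr0.
have := schwarz_pick FH _ wH; move=> /(_ (w + T%:C)); rewrite ImT => /(_ wH).
rewrite FT cImD /= addr0 !(addrC _ T%:C) !addrK normcR.
rewrite ler_pM2l; last by rewrite exprn_gt0// normr_gt0 gt_eqF.
by rewrite -!expr2 => h; rewrite -(@ler_pXn2r _ 2)// nnegrE ltW.
Qed.

(** The maximum principle for [1 / (g + i L)] gives [m + L <= normc (g p + i L)]; for large [L] the
    right side is close to [Im (g p) + L]. The bound [K] keeps the denominator away from 0. *)
Lemma minimum_principle x y A B p g (K m : R) : in_rect_interior x y A B p ->
  (forall z, in_rect x y A B z -> cderivable g z) ->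
  (forall z, in_rect x y A B z -> K <= Im (g z)) ->
  (forall z, on_bdry x y A B z -> m <= Im (g z)) ->
  m <= Im (g p).
Proof.
move=> pint dg gK gm.
have step (L : R) : 0 < K + L -> 0 < m + L -> m + L <= normc (g p + 0 +i* L).
  move=> KL mL; have gL z : in_rect x y A B z -> 0 < normc (g z + 0 +i* L).
    move=> /gK gz; apply: lt_le_trans (le_trans (ler_norm _) (le_Im_normc _)).
    by rewrite cImD/=; lra.
  have pin := gL _ (interior_in_rect pint).
  rewrite -lef_pV2 ?posrE// -Normc.normcV.
  apply: (@maximum_principle _ x y A B p (fun z => (g z + 0 +i* L)^-1)) => //.
  - move=> z zin; apply: (@cderivableV _ (fun z => g z + 0 +i* L)).
      by rewrite -normc_gt0 gL.
    by apply: cderivableD; [exact: dg|exact: cderivable_cst].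
  - by rewrite invr_ge0 ltW.
  move=> z zb; rewrite Normc.normcV lef_pV2 ?posrE//; last by apply: gL; case: zb.
  apply: le_trans (le_trans (ler_norm _) (le_Im_normc _)).
  by rewrite cImD/= lerD2r gm.
rewrite leNgt; apply/negP => lt.
pose c := Re (g p) ^+ 2 + Im (g p) ^+ 2.
have c0 : 0 <= c by rewrite addr_ge0// sqr_ge0.
pose e := m - Im (g p); have e0 : 0 < e by rewrite subr_gt0.
(* The term [c / e + 1] gives [c + e <= e * L], whereas squaring the bound in [step] yields
   [2 * e * L <= c]. *)
pose L := `|K| + `|m| + 1 + c / e.
have ce : 0 <= c / e by rewrite divr_ge0// ltW.
have := ler_norm (- K); have := ler_norm (- m); rewrite !normrN => h1 h2.
have K0 := normr_ge0 K; have m0 := normr_ge0 m.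
have L1 : 0 < K + L by rewrite /L; lra.
have L2 : 0 < m + L by rewrite /L; lra.
have := step L L1 L2.
rewrite -(@ler_pXn2r _ 2) ?nnegrE ?normc_ge0 ?(ltW L2)//.
rewrite sqr_normcE cReD cImD /= addr0 => h3.
have h4 : c + e <= e * L.
  have -> : c + e = e * (c / e + 1) by field; rewrite gt_eqF.
  by rewrite ler_wpM2l ?(ltW e0)// /L; lra.
have h5 : 0 < e * L by lra.
have h6 := sqr_ge0 m.
by move: h3 h4; rewrite /c /e; nra.
Qed.

(* Phragmen-Lindelof for the half-plane [s1 < Im]: the barrier [d * w + e * i * w ^+ 2]
   takes care of the far sides of a large rectangle. *)
Lemma phragmen_lindelof phi (s1 m : R) w0 :
  (forall z, 0 < Im z -> cderivable phi z /\ 0 <= Im (phi z)) -> 0 < s1 -> 0 <= m ->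
  (forall t, m <= Im (phi (t +i* s1))) -> s1 < Im w0 -> m <= Im (phi w0).
Proof.
move=> phiH s10 m0 phim s1w; apply/ler_addgt0Pr => eta eta0.
set x0 := Re w0; set y0 := Im w0 in s1w *.
have y00 : 0 < y0 by exact: lt_trans s1w.
(* At [w0] the barrier adds at most [eta / 2] through [d] and at most [eta / 2] through [e].
   Moreover [e * s2 ^+ 2 <= d * s1] absorbs the negative term, [d * s2 >= d * s1 + m] settles the
   top side, and [e * L ^+ 2 >= m] the vertical ones. *)
pose d := eta / (2 * y0); have d0 : 0 < d by rewrite divr_gt0// mulr_gt0.
have dy0 : d * y0 = eta / 2 by rewrite /d; field; rewrite gt_eqF.
pose s2 := s1 + y0 + m / d; have md : 0 <= m / d by rewrite divr_ge0// ltW.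
have s20 : 0 < s2 by rewrite /s2; lra.
pose e := Num.min (d * s1 / s2 ^+ 2) (eta / (2 * (x0 ^+ 2 + 1))).
have x1 : 0 < x0 ^+ 2 + 1 by rewrite ltr_wpDl ?sqr_ge0.
have e0 : 0 < e.
  rewrite lt_min; apply/andP; split; apply: divr_gt0 => //; last exact: mulr_gt0.
    exact: mulr_gt0.
  exact: exprn_gt0.
have es2 : e * s2 ^+ 2 <= d * s1.
  by rewrite -ler_pdivlMr ?exprn_gt0// /e ge_min lexx.
have ex0 : e * (x0 ^+ 2 + 1) <= eta / 2.
  apply: le_trans (_ : eta / (2 * (x0 ^+ 2 + 1)) * (x0 ^+ 2 + 1) <= _).
    by rewrite ler_wpM2r ?(ltW x1)// /e ge_min lexx orbT.
  by rewrite le_eqVlt; apply/orP; left; apply/eqP; field; rewrite gt_eqF.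
pose L := `|x0| + 1 + m / e; have me : 0 <= m / e by rewrite divr_ge0// ltW.
have ax0 := normr_ge0 x0.
have L1 : 1 <= L by rewrite /L; lra.
have eL : m <= e * L ^+ 2.
  apply: le_trans (_ : e * L <= _).
    have -> : m = e * (m / e) by field; rewrite gt_eqF.
    by rewrite ler_wpM2l ?(ltW e0)// /L; lra.
  by rewrite ler_wpM2l ?(ltW e0)// expr2 ler_peMr//; lra.
pose b z := phi z + d%:C * z + (0 +i* e) * z ^+ 2.
have Imb z : Im (b z) = Im (phi z) + d * Im z + e * (Re z ^+ 2 - Im z ^+ 2).
  rewrite /b !cImD; case: z => zx zy /=; case: (phi _) => a c /=.
  by ring.
have s12 : s1 < s2 by rewrite /s2; lra.
have sq z : s1 <= Im z <= s2 -> e * Im z ^+ 2 <= e * s2 ^+ 2.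
  move=> /andP[h1 h2]; rewrite ler_wpM2l ?(ltW e0)// lerXn2r ?nnegrE//.
    by rewrite (le_trans _ h1)// ltW.
  exact: ltW.
have ds z : s1 <= Im z <= s2 -> d * s1 <= d * Im z.
  by move=> /andP[h1 _]; rewrite ler_wpM2l// ltW.
have rs z : 0 <= e * Re z ^+ 2 by rewrite mulr_ge0 ?sqr_ge0 ?ltW.
have phi0 z : s1 <= Im z <= s2 -> 0 <= Im (phi z).
  by move=> /andP[h1 _]; apply: (phiH _ _).2; exact: lt_le_trans h1.
have s1s2 : s1 + (s2 - s1) = s2 by ring.
have : m <= Im (b w0).
  apply: (@minimum_principle (- L) s1 (L + L) (s2 - s1) w0 b 0).
  - split; apply/andP; split.
    + by have := ler_norm (- x0); rewrite normrN /L -/x0; lra.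
    + by have := ler_norm x0; rewrite /L -/x0; lra.
    + exact: s1w.
    + by rewrite s1s2 /s2 -/y0; lra.
  - move=> z [_ /andP[z1 _]]; apply: cderivableD.
      apply: cderivableD; first by apply: (phiH _ _).1; exact: lt_le_trans z1.
      by apply: cderivableM; [exact: cderivable_cst|exact: cderivable_id].
    apply: cderivableM; first exact: cderivable_cst.
    exact: (cderivableX 2 (cderivable_id z)).
  - move=> z [_]; rewrite s1s2 => zs; rewrite Imb.
    by have := sq z zs; have := ds z zs; have := phi0 z zs; have := rs z; lra.
  - move=> z [[_ zs] zb]; rewrite s1s2 in zs zb; rewrite Imb.
    have h1 := sq z zs; have h2 := ds z zs; have h3 := phi0 z zs; have h4 := rs z.
    case: zb => zE.
    + by move: h4; rewrite zE sqrrN; lra.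
    + by move: h4; rewrite zE (_ : - L + (L + L) = L); [lra|ring].
    + have := phim (Re z); rewrite -zE (_ : Re z +i* Im z = z); last by case: (z).
      lra.
    + have h5 : d * s2 = d * s1 + d * y0 + m by rewrite /s2; field; rewrite gt_eqF.
      have h6 : 0 < d * y0 by rewrite mulr_gt0.
      by rewrite zE in h1 *; lra.
rewrite Imb -/x0 -/y0 dy0.
have : 0 <= e * y0 ^+ 2 by rewrite mulr_ge0 ?sqr_ge0 ?ltW.
by lra.
Qed.

(** Schwarz-Pick for [phi + i d], whose imaginary part is positive: the right side is at most a
    constant times [d], and [d] is arbitrarily small. *)
Lemma Im_eq0_cst phi w w1 :
  (forall z, 0 < Im z -> cderivable phi z /\ 0 <= Im (phi z)) ->
  0 < Im w -> 0 < Im w1 -> Im (phi w1) = 0 -> phi w = phi w1.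
Proof.
move=> phiH wH w1H phi0; apply/eqP; rewrite -subr_eq0 -normc_eq0.
rewrite -sqrf_eq0 eq_le sqr_ge0 andbT.
have c0 : 0 < Im w * Im w1 by rewrite mulr_gt0.
rewrite -(pmulr_lle0 _ c0); apply/ler_addgt0Pr => e e0; rewrite add0r.
pose k := normc (w - w1) ^+ 2 * (Im (phi w) + 1).
have [_ phiw] := phiH _ wH.
have k0 : 0 <= k by rewrite mulr_ge0 ?sqr_ge0// addr_ge0.
pose d := Num.min 1 (e / (k + 1)).
have d0 : 0 < d by rewrite lt_min ltr01 divr_gt0// ltr_wpDl.
have d1 : d <= 1 by rewrite ge_min lexx.
have dk : d * (k + 1) <= e by rewrite -ler_pdivlMr ?ltr_wpDl// ge_min lexx orbT.
have := @schwarz_pick (fun z => phi z + 0 +i* d) w w1 _ wH w1H.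
rewrite !cImD phi0 /= add0r opprD addrACA subrr addr0 => h.
apply: le_trans (h _) _.
  move=> z /phiH[dz z0]; split; last by rewrite cImD/= ltr_wpDl.
  by apply: cderivableD => //; exact: cderivable_cst.
apply: le_trans (_ : k * d <= e); last by lra.
by rewrite /k mulrA ler_wpM2r ?(ltW d0)// ler_wpM2l ?sqr_ge0// lerD2l.
Qed.

(** By periodicity [Im phi] attains its minimum on the line of height 1. Phragmen-Lindelof carries
    this minimum up the imaginary axis, where [Im phi] becomes arbitrarily small; so it is 0, and
    [Im_eq0_cst] concludes. *)
Lemma periodic_cst phi (T : R) :
  (forall z, 0 < Im z -> cderivable phi z /\ 0 <= Im (phi z)) -> 0 < T ->
  (forall z, 0 < Im z -> phi (z + T%:C) = phi z) ->
  (forall e : R, 0 < e -> exists2 s, 1 < s & Im (phi (0 +i* s)) <= e) ->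
  forall w w', 0 < Im w -> 0 < Im w' -> phi w = phi w'.
Proof.
move=> phiH T0 phiT phiy.
have phinT n z : 0 < Im z -> phi (z + (T *+ n)%:C) = phi z.
  move=> z0; elim: n => [|n IH]; first by rewrite mulr0n addr0.
  rewrite mulrSr rmorphD/= addrA phiT//.
  by rewrite cImD/= addr0.
have cont : {within `[0, T], continuous (fun t : R => Im (phi (t +i* 1)))}.
  apply: continuous_in_subspaceT => t _.
  have [_] : ccontinuous_itv (fun t => phi (t +i* 1)) t t.
    apply: continuous_hline => s _; apply: derivable_continuous.
    by apply: (phiH _ _).1; rewrite /= ltr01.
  by apply; rewrite lexx.
have [c _ hc] := EVT_min (ltW T0) cont.
set w1 := c +i* 1 in hc; have w1H : 0 < Im w1 by rewrite /= ltr01.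
have line t : Im (phi w1) <= Im (phi (t +i* 1)).
  pose k := Num.floor (t / T); pose r := t - k%:~R * T.
  have rT : r \in `[0, T].
    have /andP[k1 k2] := floor_itv (t / T).
    rewrite in_itv/= /r subr_ge0 -ler_pdivlMr// k1/=.
    move: k2; rewrite ltr_pdivrMr// -/k intrD mulrDl mul1r => k2.
    by rewrite lerBlDl ltW.
  suff -> : phi (t +i* 1) = phi (r +i* 1) by exact: hc.
  have H s : 0 < Im (s +i* (1 : R)) by rewrite /= ltr01.
  (* [phinT] translates by natural multiples of [T] only, so for negative [k] the translation is
     applied to [t] instead of [r]. *)
  have [n kE] : exists n : nat, k = n%:Z \/ k = - n%:Z.
    by exists `|k|%N; case: (intP k) => [|n|n]; [left|left|right].
  case: kE => kE; rewrite kE in r rT *.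
  - rewrite -(phinT n (r +i* 1))//; congr phi; apply: complexP; rewrite /= ?addr0//.
    by rewrite /r -pmulrn -mulr_natl; ring.
  - rewrite -(phinT n (t +i* 1))//; congr phi; apply: complexP; rewrite /= ?addr0//.
    by rewrite /r mulrNz -pmulrn -mulr_natl; ring.
have m0 : 0 <= Im (phi w1) := (phiH _ w1H).2.
have w1E : Im (phi w1) = 0.
  apply/eqP; rewrite eq_le m0 andbT; apply/ler_addgt0Pr => e e0; rewrite add0r.
  have [s s1 hs] := phiy e e0; apply: le_trans hs.
  exact: (@phragmen_lindelof phi 1).
move=> w w' wH w'H.
by rewrite (Im_eq0_cst phiH wH w1H w1E) (Im_eq0_cst phiH w'H w1H w1E).
Qed.

End HalfPlane.

(** * Schwarz's lemma on squares *)

Section Squares.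
Variable R : realType.
Implicit Types (g F G : R[i] -> R[i]) (p z w a c k : R[i]) (r s B : R).

Lemma cderivable_affine g c k z : cderivable g (c + k * z) ->
  cderivable (fun w => g (c + k * w)) z.
Proof.
move=> [/derivable1_diffP dg]; split; apply/derivable1_diffP.
have [/derivable1_diffP d1] : cderivable (fun w => c + k * w) z.
  apply: cderivableD; first exact: cderivable_cst.
  by apply: cderivableM; [exact: cderivable_cst|exact: cderivable_id].
by have := differentiable_comp d1 dg.
Qed.

Lemma cderivable_line (n : nat) (f : 'rV[R[i]]_n -> R[i]) (a b : 'rV[R[i]]_n) z :
  differentiable f (a + z *: b) -> cderivable (fun w => f (a + w *: b)) z.
Proof.
move=> df; split; apply/derivable1_diffP.
have d1 : differentiable (fun w : R[i] => a + w *: b) z by apply: differentiableD.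
by have := differentiable_comp d1 df.
Qed.

Definition in_square r z := `|Re z| <= r /\ `|Im z| <= r.

Lemma in_squareE r z : in_rect (- r) (- r) (r + r) (r + r) z <-> in_square r z.
Proof. by rewrite /in_rect /in_square addKr !ler_norml; split. Qed.

Lemma in_squareW r r' z : r <= r' -> in_square r z -> in_square r' z.
Proof. by move=> rr [h1 h2]; split; exact: le_trans rr. Qed.

Lemma in_squareD r r' z w : in_square r z -> in_square r' w -> in_square (r + r') (z + w).
Proof.
move=> [h1 h2] [h3 h4]; split; rewrite ?cReD ?cImD.
- exact: le_trans (ler_normD _ _) (lerD h1 h3).
- exact: le_trans (ler_normD _ _) (lerD h2 h4).
Qed.

Lemma square_bdry r z : 0 < r -> on_bdry (- r) (- r) (r + r) (r + r) z ->
  in_square r z /\ r <= normc z.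
Proof.
move=> r0 [/in_squareE zin zb]; split=> //; rewrite addKr in zb.
case: zb => zE.
- by apply: le_trans (le_Re_normc z); rewrite zE normrN ger0_norm// ltW.
- by apply: le_trans (le_Re_normc z); rewrite zE ger0_norm// ltW.
- by apply: le_trans (le_Im_normc z); rewrite zE normrN ger0_norm// ltW.
- by apply: le_trans (le_Im_normc z); rewrite zE ger0_norm// ltW.
Qed.

Lemma schwarz_square r B g p : 0 < r -> 0 <= B ->
  (forall z, in_square r z -> cderivable g z) -> g 0 = 0 ->
  (forall z, in_square r z -> normc (g z) <= B) ->
  `|Re p| < r -> `|Im p| < r -> normc (g p) <= B / r * normc p.
Proof.
move=> r0 B0 dg g0 gB pr pi; rewrite -[in X in _ <= X](subr0 p).
apply: (@schwarz_rect _ (- r) (- r) (r + r) (r + r)) => //.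
- by rewrite /in_rect_interior addKr -!ltr_norml.
- by apply/in_squareE; split; rewrite /= normr0 ltW.
- by move=> z /in_squareE; exact: dg.
- by rewrite divr_ge0// ltW.
move=> z /(square_bdry r0)[zin rz]; rewrite subr0 (le_trans (gB z zin))//.
by rewrite mulrAC ler_pdivlMr// ler_wpM2l.
Qed.

(* Schwarz's lemma, applied first to a Cayley transform of [G], then to its increments,
   then to the increments of the increments. *)
Lemma increments_almost_equal G s r z : 0 < s -> 16 < r ->
  (forall z, in_square r z -> cderivable G z /\ 0 < Im (G z)) -> G 0 = 0 +i* s ->
  `|Re z| < r / 16 -> `|Im z| < r / 16 ->
  normc ((G (z + 1) - G z) - (G 1 - G 0)) <= 1024 * s / r ^+ 2 * normc z.
Proof.
move=> s0 r16 GH G0 zr zi; have r0 : 0 < r by lra.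
have ss p q : normc (p + q) <= normc p + normc q by exact: normcD.
have ssB p q : normc (p - q) <= normc p + normc q by exact: normcB.
have ns : normc (0 +i* s) = s by rewrite /= expr0n/= add0r sqrtr_sqr ger0_norm// ltW.
(* The Cayley quotient is at most [normc w / r <= 1 / 2], so [normc (G w - i s)] is at most half of
   [normc (G w - i s) + 2 * s]. *)
have bnd w : in_square (r / 4) w -> normc (G w - 0 +i* s) <= 2 * s.
  move=> [wr wi].
  have Gp p : in_square r p -> 0 < normc (G p + 0 +i* s).
    move=> /GH[_ Gp]; apply: lt_le_trans (le_trans (ler_norm _) (le_Im_normc _)).
    by rewrite cImD/= addr_gt0.
  have w2 : in_square r w by split; lra.
  have : normc ((G w - 0 +i* s) * (G w + 0 +i* s)^-1) <= 1 / r * normc w.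
    apply: (@schwarz_square r 1 (fun w => (G w - 0 +i* s) * (G w + 0 +i* s)^-1)) => //.
    - move=> p pin; have [dG _] := GH p pin; apply: cderivableM.
        by apply: cderivableB => //; exact: cderivable_cst.
      apply: (@cderivableV _ (fun w => G w + 0 +i* s)); first by rewrite -normc_gt0 Gp.
      by apply: cderivableD => //; exact: cderivable_cst.
    - by rewrite G0 subrr mul0r.
    - move=> p pin; rewrite Normc.normcM Normc.normcV ler_pdivrMr ?Gp// mul1r.
      have -> : G p + 0 +i* s = G p - (0 +i* s)^*.
        by congr (_ + _); apply: complexP; rewrite /= ?oppr0 ?opprK.
      by apply: le_normc_sub_conj => //; exact: (GH p pin).2.
    - by lra.
    - by lra.
  rewrite Normc.normcM Normc.normcV ler_pdivrMr ?Gp// => h.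
  have h1 : 1 / r * normc w <= 1 / 2.
    rewrite mul1r mulrC ler_pdivrMr//.
    by have := normc_le_ReIm w; lra.
  have h2 := ler_wpM2r (normc_ge0 (G w + 0 +i* s)) h1.
  have h3 := ss (G w - 0 +i* s) (0 +i* s + 0 +i* s).
  have h4 := ss (0 +i* s) (0 +i* s).
  rewrite addrA subrK ns in h3 h4.
  by lra.
have r4 : 0 < r / 8 by rewrite divr_gt0.
have r1 : 1 < r / 16 by lra.
have sub4 p : in_square (r / 4) p -> in_square r p.
  by apply: in_squareW; lra.
(* By [bnd] the increment from [w] is at most [4 * s] on the square of half-side [r / 8]; Schwarz at
   increment 1 gives [4 * s / (r / 8)]. *)
have incr w : in_square (r / 16) w -> normc (G (w + 1) - G w) <= 32 * s / r.
  move=> win.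
  have win4 t : in_square (r / 8) t -> in_square (r / 4) (w + 1 * t).
    move=> tin; rewrite mul1r; apply: in_squareW (in_squareD win tin).
    by lra.
  have win0 : in_square (r / 4) w by apply: in_squareW win; lra.
  have := @schwarz_square (r / 8) (4 * s) (fun t => G (w + 1 * t) - G w) 1.
  rewrite mulr1 Normc.normc1 mulr1.
  have -> : 4 * s / (r / 8) = 32 * s / r by field; rewrite gt_eqF.
  apply => //.
  - by rewrite mulr_ge0// ltW.
  - move=> t /win4/sub4/GH[dG _]; apply: cderivableB; last exact: cderivable_cst.
    exact: cderivable_affine.
  - by rewrite mulr0 addr0 subrr.
  - move=> t /win4 tin; have h1 := bnd _ tin; have h2 := bnd _ win0.
    have := ssB (G (w + 1 * t) - 0 +i* s) (G w - 0 +i* s).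
    have -> : G (w + 1 * t) - 0 +i* s - (G w - 0 +i* s) = G (w + 1 * t) - G w by ring.
    lra.
  - by rewrite normr1; lra.
  - by rewrite normr0.
have r16' : 0 < r / 16 by rewrite divr_gt0.
have := @schwarz_square (r / 16) (64 * s / r)
  (fun t => (G (1 + 1 * t) - G t) - (G 1 - G 0)) z r16'.
have -> : 64 * s / r / (r / 16) = 1024 * s / r ^+ 2 by field; rewrite gt_eqF.
cbv beta; rewrite (mul1r z) (addrC 1 z); apply => //.
- by rewrite divr_ge0 ?mulr_ge0// ltW.
- move=> t tin; apply: cderivableB; last exact: cderivable_cst.
  apply: cderivableB.
    apply: cderivable_affine; apply: (GH _ _).1; rewrite mul1r addrC.
    apply: in_squareW (in_squareD tin (_ : in_square 1 1)); first by lra.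
    by split; rewrite /= ?normr1 ?normr0.
  by apply: (GH _ _).1; apply: in_squareW tin; lra.
- by rewrite mulr0 addr0 subrr.
move=> t tin; have h1 := incr t tin.
have in0 : in_square (r / 16) 0 by split; rewrite /= normr0 ltW.
have := incr 0 in0; rewrite add0r mul1r (addrC 1 t) => h2.
have := ssB (G (t + 1) - G t) (G 1 - G 0).
have -> : 64 * s / r = 32 * s / r + 32 * s / r by field; rewrite gt_eqF.
by lra.
Qed.

(* On the square of centre [i] and half-side 1, the product of [F] with its images under
   the rotations of order 4 about [i] vanishes on the boundary. *)
Lemma vanish_at_i_of_vanish_on_reals F :
  (forall z, 0 <= Im z -> cderivable F z) -> (forall t : R, F t%:C = 0) -> F 'i%C = 0.
Proof.
move=> dF F0.
pose P (k z : R[i]) := F ('i%C + k * z).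
(* At the centre all four factors equal [F 'i%C], so the vanishing of [g 0] suffices. *)
pose g z := P 1 z * P 'i%C z * (P (-1) z * P (- 'i%C) z).
suff : normc (g 0) <= 0.
  rewrite /g /P !mulr0 !addr0 !Normc.normcM => h.
  apply/eqP; rewrite -normc_eq0 eq_le normc_ge0 andbT leNgt; apply/negP => n0.
  by move: h; rewrite leNgt !mulr_gt0.
have cP k z : 0 <= Im ('i%C + k * z) -> cderivable (P k) z.
  by move=> h; apply: cderivable_affine; exact: dF.
have bounds z : in_square 1 z -> [/\ -1 <= Re z, Re z <= 1, -1 <= Im z & Im z <= 1].
  by move=> []; rewrite !ler_norml => /andP[? ?] /andP[? ?].
have I1 z : Im ('i%C + 1 * z) = 1 + Im z by rewrite mul1r cImD.
have I2 z : Im ('i%C + 'i%C * z) = 1 + Re z.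
  by rewrite cImD; case: z => x y /=; ring.
have I3 z : Im ('i%C + -1 * z) = 1 - Im z by rewrite mulN1r cImD cImN.
have I4 z : Im ('i%C + - 'i%C * z) = 1 - Re z.
  by rewrite cImD mulNr cImN; case: z => x y /=; ring.
have z0 k z : Im ('i%C + k * z) = 0 -> P k z = 0.
  rewrite /P; case: ('i%C + k * z) => x y /= ->; exact: F0.
apply: (@maximum_principle _ (-1) (-1) (1 + 1) (1 + 1)) => //.
- by split; rewrite addKr /=; apply/andP; split; lra.
- move=> z /in_squareE zin; have [? ? ? ?] := bounds z zin.
  apply: cderivableM; apply: cderivableM; apply: cP.
  + by rewrite I1; lra.
  + by rewrite I2; lra.
  + by rewrite I3; lra.
  + by rewrite I4; lra.
move=> z [_]; rewrite addKr => zb.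
suff -> : g z = 0 by rewrite Normc.normc0.
rewrite /g; case: zb => zE.
- by rewrite (z0 'i%C) ?mulr0 ?mul0r// I2 zE subrr.
- by rewrite (z0 (- 'i%C)) ?mulr0// I4 zE subrr.
- by rewrite (z0 1) ?mul0r// I1 zE subrr.
- by rewrite (z0 (-1)) ?mul0r ?mulr0// I3 zE subrr.
Qed.

End Squares.

(** * Diagonal-fixing maps of several variables *)

Section SeveralVariables.
Variables (R : realType) (n : nat).
Implicit Types (f : 'rV[R[i]]_n -> R[i]) (x y : 'rV[R]_n) (z : 'rV[R[i]]_n) (w : R[i]).

Local Notation cvec x := (map_mx (real_complex R) x).
Local Notation one := (const_mx 1 : 'rV[R[i]]_n).

Lemma le_sum_term (I : finType) (a : I -> R) j : (forall k, 0 <= a k) -> a j <= \sum_k a k.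
Proof. by move=> a0; rewrite (bigD1 j)//= lerDl sumr_ge0. Qed.

Lemma derive_eps f a v (e : R) : differentiable f a -> 0 < e ->
  exists2 d : R, 0 < d & forall h, h != 0 -> normc h < d ->
    normc ('D_v f a - h^-1 * (f (h *: v + a) - f a)) < e.
Proof.
move=> /(@diff_derivable _ _ _ f a v)/cvgrPdist_lt df e0.
have /df : 0 < e%:C by rewrite ltcR.
move=> /nbhs_ballP[d /= d0 hd].
have [d' d'0 dE] := gtc0_real d0; exists d' => // h h0 hd'.
have := hd h; rewrite /ball/= sub0r normrN dE !normr_lt_real.
exact.
Qed.

Lemma derive_sum f a v : differentiable f a ->
  'D_v f a = \sum_j v ord0 j * 'D_(delta_mx ord0 j) f a.
Proof.
move=> df; rewrite (deriveE v df) [in LHS](row_sum_delta v) linear_sum.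
by apply: eq_bigr => j _; rewrite linearZ /= deriveE.
Qed.

(** * Displacement along real directions, and linearity *)

Section DiagonalFixing.
Variables (f : 'rV[R[i]]_n -> R[i]) (T : R).
Hypothesis f_maps : forall z, upper_half_space z -> upper_half_plane (f z).
Hypothesis f_holo : holomorphic_on (@upper_half_space R n) f.
Hypothesis f_diag : forall l : R[i], upper_half_plane l -> f (const_mx l) = l.
Hypothesis T_gt0 : 0 < T.
Hypothesis f_shift : forall z, upper_half_space z ->
  f (z + const_mx T%:C) = f z + T%:C.

Let line x w := f (cvec x + w *: one).

Let shift_upper x w : 0 < Im w -> upper_half_space (cvec x + w *: one).
Proof. by move=> w0 j; rewrite /upper_half_plane/= !mxE mulr1 cImD/= add0r. Qed.

Let line_half_plane x w : 0 < Im w -> cderivable (line x) w /\ 0 < Im (line x w).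
Proof.
move=> w0; split; last exact/f_maps/shift_upper.
exact/cderivable_line/f_holo/shift_upper.
Qed.

Let line_periodic x w : 0 < Im w -> line x (w + T%:C) = line x w + T%:C.
Proof.
move=> w0; rewrite /line -f_shift; last exact: shift_upper.
by congr f; apply/rowP => j; rewrite !mxE !mulr1 addrA.
Qed.

Let Im_line_ge x w : 0 < Im w -> Im w <= Im (line x w).
Proof.
move=> w0; apply: (Im_ge_of_translation _ w0 T_gt0); last exact: line_periodic.
exact: line_half_plane.
Qed.

(** For real multipliers of [x], the radial map used in [almost_linear] takes values of the
    functions [line]. *)
Let line_scale x (k : R) w : f (const_mx w + k%:C *: cvec x) = line (k *: x) w.
Proof. by congr (f _); apply/rowP => j; rewrite !mxE mulr1 rmorphM addrC. Qed.

(* For large [s], [w |-> f (i s + w x)] maps a square of side of order [s] to the upper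
   half-plane and [0] to [i s]. *)
Let almost_linear x : exists2 C : R, 0 < C & forall s, C < s ->
  normc (line x (0 +i* s) + line (- x) (0 +i* s) - 2 * (0 +i* s)) <= C / s /\
  normc (line (x + x) (0 +i* s) + 0 +i* s - 2 * line x (0 +i* s)) <= C / s.
Proof.
pose B := 1 + \sum_j `|x ord0 j|.
have B1 : 1 <= B by rewrite lerDl sumr_ge0.
have B0 : 0 < B by exact: lt_le_trans B1.
have xB j : `|x ord0 j| <= B.
  by apply: le_trans (@le_sum_term _ (fun j => `|x ord0 j|) j _) _ => //; rewrite lerDr.
have BB : B <= B ^+ 2 by rewrite expr2 ler_peMr// ltW.
have B20 : 0 < B ^+ 2 by rewrite exprn_gt0.
have c0 : 0 < 4096 :> R by rewrite ltr0n.
exists (4096 * B ^+ 2); first exact: mulr_gt0.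
move=> s Bs.
have s0 : 0 < s by lra.
(* Then [r * B = s / 2], so every coordinate keeps imaginary part at least [s / 2] on the square;
   and [1024 * s / r ^+ 2] becomes [4096 * B ^+ 2 / s]. *)
pose r := s / (2 * B).
have r16 : 16 < r by rewrite /r ltr_pdivlMr ?mulr_gt0//; lra.
have r0 : 0 < r by lra.
pose G w := f (const_mx (0 +i* s) + w *: cvec x).
have G_line (k : R) : G k%:C = line (k *: x) (0 +i* s) by exact: line_scale.
have G_upper w : in_square r w -> upper_half_space (const_mx (0 +i* s) + w *: cvec x).
  move=> [_ wi] j; rewrite /upper_half_plane/= !mxE cImD cImM /= mulr0 add0r.
  have h1 : `|Im w * x ord0 j| <= r * B by rewrite normrM ler_pM.
  have h2 : r * B = s / 2 by rewrite /r; field; rewrite gt_eqF.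
  by move: h1; rewrite h2 ler_norml => /andP[h1 _]; lra.
have GH w : in_square r w -> cderivable G w /\ 0 < Im (G w).
  move=> /G_upper wu; split; last exact: f_maps.
  exact/cderivable_line/f_holo.
have G0 : G 0 = 0 +i* s.
  by rewrite /G scale0r addr0 f_diag.
(* [k = -1] yields the estimate for [x] and [- x], [k = 1] the one for [x + x]. *)
have incr (k : R) : `|k| = 1 ->
    normc (G (k%:C + 1) - G k%:C - (G 1 - G 0)) <= 4096 * B ^+ 2 / s.
  move=> k1; have := @increments_almost_equal _ G s r k%:C s0 r16 GH G0.
  rewrite normcR k1 mulr1 (_ : Im k%:C = 0)// normr0.
  have -> : 1024 * s / r ^+ 2 = 4096 * B ^+ 2 / s.
    by rewrite /r; field; rewrite !gt_eqF.
  by apply; lra.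
have G1 : G 1 = line x (0 +i* s) by rewrite (G_line 1) scale1r.
have eN1 : -1 = (-1)%:C :> R[i] by apply: complexP; rewrite /= ?oppr0.
have e2 : 1 + 1 = (1 + 1)%:C :> R[i] by apply: complexP; rewrite /= ?addr0.
have GN1 : G (-1) = line (- x) (0 +i* s) by rewrite eN1 G_line scaleN1r.
have G2 : G (1 + 1) = line (x + x) (0 +i* s) by rewrite e2 G_line scalerDl scale1r.
split.
- have := incr (-1); rewrite normrN1 => /(_ erefl).
  rewrite -eN1 addNr G1 GN1 G0 -normcNE.
  by congr (normc _ <= _); ring.
- have := incr 1; rewrite normr1 => /(_ erefl).
  rewrite -[1%:C]/(1 : R[i]) G2 G1 G0.
  by congr (normc _ <= _); ring.
Qed.

Let disp x := line x 'i%C - 'i%C.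

(** [periodic_cst] applies to [line x w - w]: at [0 +i* s] the imaginary parts for [x] and [- x] sum
    to at most [C / s], and both are nonnegative by [Im_line_ge]. *)
Let line_translation x w : 0 < Im w -> line x w = w + disp x.
Proof.
move=> w0; apply/eqP; rewrite addrC -subr_eq; apply/eqP.
apply: (@periodic_cst _ (fun w => line x w - w) T) => //.
- move=> z z0; have [dz _] := line_half_plane x z0; split.
    by apply: cderivableB => //; exact: cderivable_id.
  by rewrite cImD cImN subr_ge0 Im_line_ge.
- by move=> z z0; rewrite line_periodic// opprD addrACA subrr addr0.
move=> e e0; have [C C0 hC] := almost_linear x.
(* Exceeds both [C] and 1, and makes the error [C / s] at most [e]. *)
exists (C + 1 + C / e).
  by rewrite -addrA addrCA ltrDl addr_gt0// divr_gt0.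
set s := C + 1 + C / e; have Ce : 0 < C / e by rewrite divr_gt0.
have sC : C < s by rewrite /s; lra.
have s0 : 0 < s by exact: lt_trans sC.
have [h _] := hC s sC.
have h1 := Im_line_ge (- x) (_ : 0 < Im (0 +i* s)); have {}h1 := h1 s0.
have h2 := le_trans (le_trans (ler_norm _) (le_Im_normc _)) h.
have h3 : C / s <= e.
  rewrite ler_pdivrMr// mulrC -ler_pdivrMr// /s; lra.
move: h2 h1; rewrite !cImD !cImN cImM /=; lra.
Qed.

(** In the second estimate of [almost_linear] the terms in [s] cancel once each line is a
    translation, while the error [C / s] tends to 0. *)
Let disp_double x : disp (x + x) = 2 * disp x.
Proof.
have [C C0 hC] := almost_linear x.
apply/eqP; rewrite -subr_eq0 -normc_eq0 eq_le normc_ge0 andbT.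
apply/ler_addgt0Pr => e e0; rewrite add0r.
pose s := C + 1 + C / e; have Ce : 0 < C / e by rewrite divr_gt0.
have sC : C < s by rewrite /s; lra.
have s0 : 0 < s by exact: lt_trans sC.
have [_] := hC s sC; rewrite !line_translation//.
have -> : 0 +i* s + disp (x + x) + 0 +i* s - 2 * (0 +i* s + disp x) =
  disp (x + x) - 2 * disp x by ring.
move=> /le_trans; apply.
by rewrite ler_pdivrMr// mulrC -ler_pdivrMr// /s; lra.
Qed.

Let disp_half x k : disp x = 2 ^+ k * disp ((2 ^- k) *: x).
Proof.
elim: k => [|k IH]; first by rewrite expr0 invr1 scale1r mul1r.
rewrite IH exprSr -mulrA -disp_double -scalerDl; congr (_ * disp (_ *: _)).
by rewrite exprS; field; rewrite expf_neq0.
Qed.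

Let diag_upper w : 0 < Im w -> upper_half_space (const_mx w : 'rV_n).
Proof. by move=> w0 j; rewrite /upper_half_plane /= mxE. Qed.

Let i_gt0 : 0 < Im ('i%C : R[i]). Proof. by rewrite /= ltr01. Qed.

(** By [disp_half] the difference quotient of [f] at the point [i] for the increment [2 ^- k] is
    exactly [disp x]; homogeneity along powers of 2 thus identifies the derivative. *)
Let disp_derive x : disp x = 'D_(cvec x) f (const_mx 'i%C).
Proof.
have df := f_holo (diag_upper i_gt0).
apply/esym/eqP; rewrite -subr_eq0 -normc_eq0 eq_le normc_ge0 andbT.
apply/ler_addgt0Pr => e e0; rewrite add0r.
have [d d0 hd] := derive_eps (cvec x) df e0.
have [k hk] : exists k, (2 ^- k : R) < d.
  have : (geometric 1 (2^-1 : R)) @ \oo --> (0 : R).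
    by apply: cvg_geometric; rewrite ger0_norm ?invr_ge0// invf_lt1// ltr1n.
  move=> /cvgrPdist_lt/(_ _ d0)[k _ /(_ k (leqnn k))] /=.
  rewrite sub0r normrN mul1r exprVn ger0_norm ?invr_ge0 ?exprn_ge0// => hk.
  by exists k.
have k0 : 0 < 2 ^- k :> R by rewrite invr_gt0 exprn_gt0.
have := hd (2 ^- k)%:C; rewrite normcR gtr0_norm// => /(_ _ hk)/ltW.
have -> : f ((2 ^- k)%:C *: cvec x + const_mx 'i%C) = 'i%C + disp ((2 ^- k) *: x).
  rewrite -(line_translation _ i_gt0) /line; congr f; apply/rowP => j.
  by rewrite !mxE mulr1 rmorphM.
rewrite f_diag// [_ + disp _]addrC addrK (_ : (2 ^- k)%:C^-1 = 2 ^+ k) -?disp_half; last first.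
  by rewrite fmorphV invrK rmorphXn rmorph_nat.
by apply; rewrite -normc_gt0 normcR gtr0_norm.
Qed.

Let alpha j := partial_derivative f j (const_mx 'i%C).

Let dispE x : disp x = \sum_j alpha j * (x ord0 j)%:C.
Proof.
rewrite disp_derive (derive_sum _ (f_holo (diag_upper i_gt0))).
by apply: eq_bigr => j _; rewrite mxE mulrC.
Qed.

(** Evaluates [dispE] at the all-ones direction, where [f] is known on the diagonal. *)
Let sum_alpha : \sum_j alpha j = 1.
Proof.
have := dispE (const_mx 1); rewrite /disp /line.
have -> : cvec (const_mx 1) + 'i%C *: one = const_mx (1 + 'i%C).
  by apply/rowP => j; rewrite !mxE mulr1.
rewrite f_diag; last by rewrite /upper_half_plane/= add0r ltr01.
rewrite addrK => ->; apply: eq_bigr => j _.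
by rewrite mxE mulr1.
Qed.

(** [z] is the point [w = i] of the complex line [a + w v], where [a] has all imaginary parts equal
    to [s] and [v] is real and positive. For real [w] the imaginary parts are all equal and
    [line_translation] gives the formula; [vanish_at_i_of_vanish_on_reals] carries it to [w = i]. *)
Lemma diagonal_fixing_linear z : upper_half_space z ->
  f z = \sum_j alpha j * z ord0 j.
Proof.
move=> zH; have z0 j : 0 < Im (z ord0 j) by exact: zH.
(* A height [s] strictly between 0 and every [Im z_j], so that the line stays in the domain whenever
   [0 <= Im w]. *)
pose S := 1 + \sum_j (Im (z ord0 j))^-1; pose s := S^-1.
have S0 : 0 < S by rewrite ltr_pwDl// sumr_ge0// => j _; rewrite invr_ge0 ltW.
have s0 : 0 < s by rewrite invr_gt0.
have sz j : s < Im (z ord0 j).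
  rewrite /s -(invrK (Im _)) ltf_pV2 ?posrE ?invr_gt0//.
  apply: le_lt_trans (@le_sum_term _ (fun j => (Im (z ord0 j))^-1) j _) _ => [k|].
    by rewrite invr_ge0 ltW.
  by rewrite ltrDr.
pose x : 'rV[R]_n := \row_j Re (z ord0 j).
pose v : 'rV[R]_n := \row_j (Im (z ord0 j) - s).
pose a := cvec x + (0 +i* s) *: one.
pose L (u : 'rV[R[i]]_n) := \sum_j alpha j * u ord0 j.
have LD u u' (k : R[i]) : L (u + k *: u') = L u + k * L u'.
  rewrite /L mulr_sumr -big_split; apply: eq_bigr => j _ /=.
  by rewrite !mxE mulrDr mulrCA.
have up w : 0 <= Im w -> upper_half_space (a + w *: cvec v).
  move=> w0 j; rewrite /upper_half_plane/= /a !mxE mulr1.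
  rewrite !cImD cImM /= mulr0 add0r add0r ltr_pwDl// mulr_ge0//.
  by rewrite subr_ge0 ltW.
pose K w := f (a + w *: cvec v) - (L a + L (cvec v) * w).
have zE : a + 'i%C *: cvec v = z.
  apply/rowP => j; rewrite /a !mxE mulr1; case: (z ord0 j) => p q /=.
  by apply: complexP => /=; ring.
suff : K 'i%C = 0.
  by rewrite /K (mulrC (L _)) -LD zE => /eqP; rewrite subr_eq0 => /eqP.
apply: vanish_at_i_of_vanish_on_reals => [w w0|t].
  apply: cderivableB; first exact/cderivable_line/f_holo/up.
  apply: cderivableD; first exact: cderivable_cst.
  by apply: cderivableM; [exact: cderivable_cst|exact: cderivable_id].
rewrite /K (mulrC (L _)) -LD; apply/eqP; rewrite subr_eq0; apply/eqP.
have -> : a + t%:C *: cvec v = cvec (x + t *: v) + (0 +i* s) *: one.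
  by rewrite /a addrAC map_mxD map_mxZ.
rewrite -/(line _ _) line_translation// dispE LD addrC; congr (_ + _).
- by apply: eq_bigr => j _; rewrite !mxE.
- rewrite -[LHS]mulr1 -[in LHS]sum_alpha; congr (_ * _).
  by apply: eq_bigr => j _; rewrite mxE mulr1.
Qed.

End DiagonalFixing.
End SeveralVariables.

Theorem corollary4p3 (R : realType) (n : nat) (hn : (1 <= n)%N)
    (f : 'rV[R[i]]_n -> R[i])
    (f_maps : forall z, upper_half_space z -> upper_half_plane (f z))
    (f_holo : holomorphic_on (@upper_half_space R n) f)
    (f_diag : forall l : R[i], upper_half_plane l -> f (const_mx l) = l)
    (f_shift : exists T : R, 0 < T /\
       forall z, upper_half_space z ->
         f (z + const_mx T%:C) = f z + T%:C) :
  forall z, upper_half_space z ->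
    f z = \sum_(j < n) partial_derivative f j (const_mx 'i%C) * z ord0 j.
Proof.
by case: f_shift => T [T0 fT] z; exact: (diagonal_fixing_linear f_maps f_holo f_diag T0 fT).
Qed.
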